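(* Let $\boldsymbol{\theta}$ be a torsion-free directive sequence with length sequence $(q_n)_{n\ge0}$, defined on a sequence of alphabets of bounded size. Then the maximal equicontinuous factor of $(X_{\boldsymbol\theta},\sigma)$ is $\mathbb Z_{(q_n)}\times\mathbb Z/h\mathbb Z$ (with rotation by $(1,1)$) for some $h\ge1$ coprime to each $q_n$. In particular each continuous eigenvalue of $(X_{\boldsymbol\theta},\sigma)$ is rational, i.e. a root of unity.
   Context: Alphabets are finite sets. A morphism $\theta:\mathcal A\to\mathcal B^+$ maps letters to non-empty words and is extended by concatenation to words and to $\mathcal A^{\mathbb Z}$. $\sigma$ is the left shift. A directive sequence is a sequence $\boldsymbol\theta=(\theta^{(n)})_{n\ge 0}$ of morphisms $\theta^{(n)}:\mathcal A_{n+1}\to\mathcal A_n^+$; the alphabets are of bounded size if $\sup_n|\mathcal A_n|<\infty$. Put $\theta^{[n,N)}=\theta^{(n)}\circ\cdots\circ\theta^{(N-1)}$. $X^{(n)}_{\boldsymbol\theta}$ is the set of $x\in\mathcal A_n^{\mathbb Z}$ all of whose finite subwords are subwords of $\theta^{[n,N)}(a)$ for some $N>n$ and $a\in\mathcal A_N$; $X_{\boldsymbol\theta}=X^{(0)}_{\boldsymbol\theta}$. $\boldsymbol\theta$ is constant-length with length sequence $(q_n)$ if $|\theta^{(n)}(a)|=q_n$ for all $n$ and all $a\in\mathcal A_{n+1}$. $\boldsymbol\theta$ is torsion-free if it is constant-length with length sequence $(q_n)$, $q_n>1$ for infinitely many $n$, each $(X^{(n)}_{\boldsymbol\theta},\sigma)$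 is minimal, $X^{(0)}_{\boldsymbol\theta}$ is aperiodic (contains no $\sigma$-periodic point), and every prime dividing some $q_k$ divides $q_n$ for infinitely many $n$. With $p_0=1$ and $p_n=q_0\cdots q_{n-1}$, $\mathbb Z_{(q_n)}=\varprojlim\mathbb Z/p_n\mathbb Z$. The maximal equicontinuous factor of a system is the equicontinuous factor through which every other equicontinuous factor factors (unique up to conjugacy). $\lambda\in S^1$ is a continuous eigenvalue of $(X,\sigma)$ if there is a nonzero continuous $f:X\to\mathbb C$ with $f\circ\sigma=\lambda f$. *)

(* Defs.v *)
From HB Require Import structures.
From mathcomp Require Import all_boot all_order all_algebra.
From mathcomp Require Import complex.
From mathcomp Require Import all_classical all_reals all_analysis.

Set Implicit Arguments.
Unset Strict Implicit.
Unset Printing Implicit Defensive.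

Import Order.TTheory GRing.Theory Num.Theory.
Import numFieldNormedType.Exports.

Local Open Scope classical_set_scope.
Local Open Scope ring_scope.

(* A system is a carrier set [X] in an ambient topological space [U] together with
   a map [T : U -> U], of which only the restriction to [X] is relevant. *)

(* Invariance is two-sided, as for an action of the integers. The sets [F] are
   closed in [U], hence in [X]; the converse holds as [minimal] is only used for
   closed [X]. *)
Definition minimal (U : topologicalType) (X : set U) (T : U -> U) : Prop :=
  X !=set0 /\
  forall F : set U, closed F -> F `<=` X -> T @` F = F -> F = set0 \/ F = X.

Definition factor_map (U V : topologicalType)
    (X : set U) (T : U -> U) (Y : set V) (S : V -> V) (pi : U -> V) : Prop :=
  [/\ {within X, continuous pi}, pi @` X = Y
    & forall x, X x -> pi (T x) = S (pi x)].

(* For [S] a bijection of [Y], the power [S ^ n] on [Y]. *)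
Definition ziter (V : pointedType) (Y : set V) (S : V -> V) (n : int) : V -> V :=
  match n with
  | Posz k => iter k S
  | Negz k => iter k.+1 (pinv Y S)
  end.

(* On a compact Hausdorff carrier a continuous bijection is a homeomorphism, and
   there is only one compatible uniformity. The type [subspace Y] is a copy of
   [V] with the topology induced on [Y], the points outside [Y] being isolated:
   equicontinuity is only tested on [Y]. *)
Definition equicontinuous_system (V : puniformType) (Y : set V) (S : V -> V)
    : Prop :=
  [/\ hausdorff_space V, compact Y, {within Y, continuous S}, set_bij Y Y S
    & @equicontinuous (subspace Y) V int setT (ziter Y S)].

(* The competing factors range over compact Hausdorff systems; as factors of a
   compact metrizable system these are metrizable. *)
Definition is_maximal_equicontinuous_factor (U : topologicalType) (X : set U)
    (T : U -> U) (Z : puniformType) (M : set Z) (rho : Z -> Z) : Prop :=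
  equicontinuous_system M rho /\
  exists2 pi : U -> Z, factor_map X T M rho pi &
    forall (V : puniformType) (Y : set V) (S : V -> V) (phi : U -> V),
      equicontinuous_system Y S -> factor_map X T Y S phi ->
      exists2 psi : Z -> V, factor_map M rho Y S psi &
        forall x, X x -> phi x = psi (pi x).

Definition continuous_eigenvalue (R : realType) (U : topologicalType)
    (X : set U) (T : U -> U) (lambda : R[i]) : Prop :=
  `|lambda| = 1 /\
  exists f : U -> R[i]^o,
    [/\ {within X, continuous f}, exists2 x, X x & f x != 0
      & forall x, X x -> f (T x) = lambda * f x].

Record directive_sequence (A : nat -> finType) := DirectiveSequence {
  morph :> forall n, A n.+1 -> seq (A n);
  morph_neq_nil : forall n (a : A n.+1), @morph n a != [::]
}.

Arguments morph {A} d n a.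

(* [compose theta n k] is the composition of the [k] morphisms
   [theta n], ..., [theta (n + k - 1)], restricted to letters. *)
Fixpoint compose (A : nat -> finType) (theta : directive_sequence A) (n k : nat)
    : A (k + n)%N -> seq (A n) :=
  match k with
  | 0%N => fun a => [:: a]
  | k'.+1 => fun a =>
      flatten [seq compose theta b | b <- theta (k' + n)%N a]
  end.

Definition full_shift (A : finType) :=
  {ptws int -> discrete_topology A}.

Definition left_shift (A : finType) (x : full_shift A) : full_shift A :=
  fun i => x (i + 1).

Definition subword (A : finType) (x : full_shift A) (i : int) (l : nat) : seq A :=
  [seq x (i + j%:Z) | j <- iota 0 l].

Definition S_adic_shift (A : nat -> finType) (theta : directive_sequence A)
    (n : nat) : set (full_shift (A n)) :=
  [set x | forall i l, exists k (a : A (k.+1 + n)%N),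
     infix (subword x i l) (compose theta a)].

Arguments S_adic_shift {A} theta n _.

Definition bounded_alphabets (A : nat -> finType) : Prop :=
  exists K : nat, forall n, (#|A n| <= K)%N.

Definition constant_length (A : nat -> finType) (theta : directive_sequence A)
    (q : nat -> nat) : Prop :=
  forall n (a : A n.+1), size (theta n a) = q n.

Definition aperiodic (A : finType) (X : set (full_shift A)) : Prop :=
  forall x k, X x -> (0 < k)%N -> iter k (@left_shift A) x <> x.

Record torsion_free (A : nat -> finType) (theta : directive_sequence A)
    (q : nat -> nat) : Prop := TorsionFree {
  tf_constant_length : constant_length theta q;
  tf_growth : forall N, exists2 n, (N <= n)%N & (1 < q n)%N;
  tf_minimal : forall n, minimal (S_adic_shift theta n) (@left_shift (A n));
  tf_aperiodic : aperiodic (S_adic_shift theta 0);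
  tf_primes : forall p k, prime p -> (p %| q k)%N ->
    forall N, exists2 n, (N <= n)%N & (p %| q n)%N
}.

(* The integers modulo [m], for [m > 0]; ['Z_m] would be wrong for [m = 1]. *)
Definition cyclic_group (m : nat) : Type := discrete_topology 'I_m.-1.+1.

HB.instance Definition _ (m : nat) :=
  GRing.Zmodule.copy (cyclic_group m) 'I_m.-1.+1.
HB.instance Definition _ (m : nat) := isPointed.Build (cyclic_group m) 0.
HB.instance Definition _ (m : nat) :=
  DiscreteUniform.copy (cyclic_group m) (discrete_topology 'I_m.-1.+1).

Definition cyclic_one (m : nat) : cyclic_group m := Zp1.

Definition level (q : nat -> nat) (n : nat) : nat := (\prod_(k < n) q k)%N.

Definition odometer_space (q : nat -> nat) :=
  prod_topology (fun n => cyclic_group (level q n)).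

HB.instance Definition _ (q : nat -> nat) :=
  Uniform.copy (odometer_space q)
    (prod_topology (fun n => cyclic_group (level q n))).
HB.instance Definition _ (q : nat -> nat) :=
  isPointed.Build (odometer_space q) (fun=> 0).

(* The inverse limit of the integers modulo [level q n]; [inZp] is the reduction
   modulo [level q n]. *)
Definition odometer (q : nat -> nat) : set (odometer_space q) :=
  [set z | forall n, z n = inZp (z n.+1 : 'I_(level q n.+1).-1.+1)].

Arguments odometer q _ : clear implicits.

Definition odometer_cyclic_space (q : nat -> nat) (h : nat) : Type :=
  (odometer_space q * cyclic_group h)%type.

HB.instance Definition _ (q : nat -> nat) (h : nat) :=
  Uniform.copy (odometer_cyclic_space q h)
    (odometer_space q * cyclic_group h)%type.
HB.instance Definition _ (q : nat -> nat) (h : nat) :=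
  isPointed.Build (odometer_cyclic_space q h) (point, point).

Definition odometer_cyclic (q : nat -> nat) (h : nat)
    : set (odometer_cyclic_space q h) :=
  odometer q `*` [set: cyclic_group h].

Arguments odometer_cyclic q h _ : clear implicits.

Definition rotation (q : nat -> nat) (h : nat) (z : odometer_cyclic_space q h)
    : odometer_cyclic_space q h :=
  (fun n => z.1 n + cyclic_one (level q n), z.2 + cyclic_one h).

(* Main.v *)
Require Import Defs.
From mathcomp Require Import all_boot all_order all_algebra.
From mathcomp Require Import complex finmap.
From mathcomp Require Import all_classical all_reals all_analysis.
From mathcomp Require Import zify ring lra.

Set Implicit Arguments.
Unset Strict Implicit.
Unset Printing Implicit Defensive.

Import Order.TTheory GRing.Theory Num.Theory.
Import numFieldNormedType.Exports.

Local Open Scope classical_set_scope.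
Local Open Scope ring_scope.

(* Write T for the shift on X, p_n for [level q n], and let d(N) be the number of
   minimal components of T^N. Every point of X is cut, for each n, into blocks of
   length p_n indexed by at most K letters.
   If c = p_n / d(p_n) were larger than K! + K, then blocks would start at every
   multiple of d(p_n); among K + 1 consecutive ones two coincide, so the point would
   be periodic of period K! d(p_n). Hence c is bounded, and since every prime of some
   q_k occurs infinitely often, each p_n divides some d(p_N): this gives the factor
   maps onto the cyclic groups of order p_n.
   Conversely, among K + 1 equally spaced blocks of length p_n two coincide. Along an
   equicontinuous factor map phi this makes phi (T^(p_n K! m) x) close to phi x,
   uniformly in m and x, when n is large. So phi is almost constant on the minimal
   components of T^(p_n K!), and d(p_n K!) divides p_N h for some N, where h = d(K2)
   for the part K2 of K! that is coprime to all q_k. For an eigenfunction, all powers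
   of lambda^(p_n K!) are close to 1, so that lambda^(p_n K!) = 1. *)

(** * Pigeonhole principles, concatenated blocks and product uniformities *)

(** If each [j] failed at some [f j], all would fail at the maximum of the [f j]. This serves as a
    compactness argument: one residue works for all window lengths. *)
Lemma antitone_pigeonhole (n : nat) (P : 'I_n -> nat -> Prop) :
  (forall j l l', (l <= l')%N -> P j l' -> P j l) ->
  (forall l, exists j, P j l) -> exists j, forall l, P j l.
Proof.
move=> anti ex; apply: contrapT => /forallNP noj.
have /choice [f fP] : forall j, exists l, ~ P j l.
  by move=> j; apply/existsNP; exact: noj.
have [j Pj] := ex (\max_j f j)%N.
by apply: (fP j); apply: anti Pj; exact: leq_bigmax.
Qed.

Lemma pigeonhole_seq (T : finType) (K : nat) (f : nat -> T) : (#|T| <= K)%N ->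
  exists r1 r2, [/\ (r1 < r2)%N, (r2 <= K)%N & f r1 = f r2].
Proof.
move=> TK; apply: contrapT => nof.
suff /leq_card : injective (fun i : 'I_K.+1 => f i).
  by rewrite card_ord => /leq_trans/(_ TK); rewrite ltnn.
move=> i j fij; apply: val_inj; apply: contrapT => /eqP; rewrite neq_ltn => /orP[] ij.
  by apply: nof; exists i, j; split => //; rewrite -ltnS; exact: ltn_ord.
by apply: nof; exists j, i; split => //; rewrite -ltnS; exact: ltn_ord.
Qed.

Lemma size_flatten_uniform (T : Type) (P : nat) (ss : seq (seq T)) :
  (forall i, (i < size ss)%N -> size (nth [::] ss i) = P) ->
  size (flatten ss) = (P * size ss)%N.
Proof.
elim: ss => [|s ss IHss] szP /=; first by rewrite muln0.
rewrite size_cat mulnS IHss => [|i iss]; last exact: (szP i.+1).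
by rewrite -(szP 0%N).
Qed.

Lemma nth_flatten_uniform (T : Type) (P : nat) (x0 : T) (ss : seq (seq T)) i t :
  (forall i, (i < size ss)%N -> size (nth [::] ss i) = P) ->
  (i < size ss)%N -> (t < P)%N ->
  nth x0 (flatten ss) (P * i + t) = nth x0 (nth [::] ss i) t.
Proof.
elim: ss i => [//|s ss IHss] i szP /= iss tP.
have sP : size s = P by exact: (szP 0%N).
case: i iss => [|i] iss /=; rewrite nth_cat sP; first by rewrite muln0 add0n tP.
rewrite mulnS -addnA ltnNge leq_addr /= addKn IHss // => j jss.
exact: (szP j.+1).
Qed.

Lemma nth_cat_mid (T : Type) (c0 : T) (p s p' : seq T) t : (t < size s)%N ->
  nth c0 (p ++ s ++ p') (size p + t) = nth c0 s t.
Proof. by move=> ts; rewrite nth_cat ltnNge leq_addr /= addKn nth_cat ts. Qed.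

Lemma dvdn_gcd_mul d u v : (d %| u * v)%N -> (d %| gcdn d u * gcdn d v)%N.
Proof.
move=> duv; rewrite muln_gcdr dvdn_gcd dvdn_mull //=.
by rewrite muln_gcdl dvdn_gcd dvdn_mulr //= duv.
Qed.

Lemma nbhs_prod_discrete (I : eqType) (T : I -> discreteTopologicalType)
    (x : prod_topology T) (B : set (prod_topology T)) :
  nbhs x B <->
  exists s : seq I, forall y : prod_topology T,
    (forall i, i \in s -> y i = x i) -> B y.
Proof.
pose cyl (s : seq I) := [set y : prod_topology T | forall i, i \in s -> y i = x i].
have NF : Filter (nbhs x) := nbhs_filter x.
split=> [xB|[s sB]]; last first.
  have cylx : nbhs x (cyl s).
    elim: s {sB} => [|i s IHs].
      by apply: (@filterS _ _ NF setT) => [y _ j|]; [rewrite in_nil|exact: filterT].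
    have xi : nbhs x (@proj I T i @^-1` [set x i]).
      by apply: proj_continuous; exact: discrete_set1.
    apply: (@filterS _ _ NF _ _ _ (filterI xi IHs)) => y [/= yi ys] j.
    by rewrite in_cons => /predU1P[-> //|]; exact: ys.
  by apply: (@filterS _ _ NF _ _ _ cylx) => y; exact: sB.
pose F := filter_from [set: seq I] cyl.
have FF : Filter F.
  apply: filter_from_filter; first by exists [::].
  move=> s1 s2 _ _; exists (s1 ++ s2) => // y ys.
  by split=> i si; apply: ys; rewrite mem_cat si ?orbT.
(* The product topology is a supremum of weak topologies, so convergence of the cylinder filter is
   tested one coordinate at a time. *)
suff Fx : F --> x by have [s _ sB] := Fx B xB; exists s.
apply/cvg_sup => i C [_ [[D _ <-] Dx] DC].
exists [:: i] => // y /(_ i); rewrite inE eqxx => /(_ isT) yi.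
by apply: DC => /=; rewrite yi.
Qed.

Lemma entourage_prod_discrete (I : eqType) (T : I -> discreteUniformType)
    (E : set (prod_topology T * prod_topology T)) :
  entourage E ->
  exists s : seq I, forall x y : prod_topology T,
    (forall i, i \in s -> x i = y i) -> E (x, y).
Proof.
case=> _ [F _ <-] FE.
suff [s sF] : exists s : seq I, forall x y : prod_topology T,
    (forall i, i \in s -> x i = y i) -> forall p, p \in enum_fset F -> (val p).2 (x, y).
  by exists s => x y /sF xyF; apply: FE.
elim: (enum_fset F) => [|[[i D] /= entD] l [s sl]]; first by exists [::].
exists (i :: s) => x y xy p; rewrite in_cons => /predU1P[->/=|].
  have /asboolP [C] := entD; rewrite uniform_discrete => Cdiag; apply.
  by apply: Cdiag; exists (x i) => //; congr pair; apply: xy; rewrite mem_head.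
by apply: sl => j js; apply: xy; rewrite in_cons js orbT.
Qed.

(** Splitting the entourage once per link controls chains of bounded length. Here [c] will be [K!],
    while the number of links actually used varies with the point. *)
Lemma entourage_chain (V : uniformType) (E : set (V * V)) (c : nat) : entourage E ->
  exists2 E', entourage E' & forall u : nat -> V, (forall i, E' (u i, u i.+1)) ->
    forall i, (i <= c)%N -> E (u 0%N, u i).
Proof.
elim: c E => [|c IHc] E entE.
  by exists E => // u _ i; rewrite leqn0 => /eqP ->; exact: entourage_refl.
have entS : entourage (split_ent E) by exact: entourage_split_ent.
have [E' entE' E'P] := IHc _ entS.
exists (E' `&` split_ent E); first exact: filterI.
move=> u uE [|i] ic; first exact: entourage_refl.
apply: (entourage_split (u i)) => //; last by have [] := uE i.
by apply: E'P => // k; have [] := uE k.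
Qed.

Lemma hausdorff_entourage_eq (V : uniformType) (a b : V) : hausdorff_space V ->
  (forall E, entourage E -> E (a, b)) -> a = b.
Proof.
move=> hV ab; apply: hV => B C /nbhsP[E entE EB] /nbhs_singleton Cb.
by exists b; split => //; apply: EB; apply/xsectionP; exact: ab.
Qed.

(** Along an orbit [pinv] undoes [S], so negative powers follow the orbit backwards. This turns
    [ziter] into translates or rotations. *)
Lemma ziter_orbit (V : pointedType) (Y : set V) (S : V -> V) (t : int -> V) :
  set_bij Y Y S -> (forall k, Y (t k)) -> (forall k, t (k + 1) = S (t k)) ->
  forall k, ziter Y S k (t 0) = t k.
Proof.
move=> [_ Sinj _] Yt tS.
have pinvS z : Y z -> pinv Y S (S z) = z.
  by move=> Yz; apply: pinvKV; rewrite ?inE //; exact: Sinj.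
case=> n; first by elim: n => //= n ->; rewrite -tS -addn1 PoszD.
elim: n => [|n IHn]; first by rewrite /= -[0](_ : Negz 0 + 1 = _) // tS pinvS.
have := IHn; rewrite /= => ->; rewrite (_ : Negz n = Negz n.+1 + 1); last by lia.
by rewrite tS pinvS.
Qed.

Lemma cyclic_one_mulrn m (n : nat) : cyclic_one m *+ n = (inZp n : 'I_m.-1.+1).
Proof.
apply: val_inj; rewrite [X in val X](Zp_mulrn (Zp1 : 'I_m.-1.+1) n) /=.
by rewrite modnMml mul1n.
Qed.

Lemma cyclic_one_mulrn_mod m (n : nat) (a : cyclic_group m) : (0 < m)%N ->
  n = (a : 'I_m.-1.+1) %[mod m] -> cyclic_one m *+ n = a.
Proof.
rewrite cyclic_one_mulrn; case: m a => // m a _ /= na; apply: val_inj => /=.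
by rewrite na modn_small.
Qed.

Lemma cyclic_one_mulz_eq0 m k : (0 < m)%N ->
  (cyclic_one m *~ k == 0) = (m %| k)%Z.
Proof.
move=> m0; have natP (n : nat) : (cyclic_one m *+ n == 0) = (m %| n)%N.
  rewrite (cyclic_one_mulrn m n : _ = inZp n :> 'I_m.-1.+1).
  by rewrite -val_eqE /= prednK.
case: k => n; first exact: natP.
by rewrite NegzE mulrNz oppr_eq0 natP dvdzE abszN.
Qed.

Lemma cyclic_one_mulz_mod m N k : (0 < N)%N -> (m %| N)%N ->
  cyclic_one m *~ k = cyclic_one m *+ `|(k %% N)%Z|.
Proof.
move=> N0 mN; have m0 : (0 < m)%N by exact: dvdn_gt0 mN.
apply/eqP; rewrite -subr_eq0 -[_ *+ _]/(_ *~ Posz _) -mulrzBr cyclic_one_mulz_eq0 //.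
rewrite gez0_abs; last by apply: modz_ge0; lia.
by rewrite [X in X - _](divz_eq k N) addrK dvdz_mull // dvdzE.
Qed.

Lemma level_recr (q : nat -> nat) n : level q n.+1 = (level q n * q n)%N.
Proof. by rewrite /level big_ord_recr. Qed.

Lemma level_dvd (q : nat -> nat) n m : (n <= m)%N -> (level q n %| level q m)%N.
Proof.
elim: m => [|m IHm]; first by rewrite leqn0 => /eqP ->.
rewrite leq_eqVlt => /predU1P[->//|]; rewrite ltnS => /IHm nm.
by rewrite level_recr dvdn_mulr.
Qed.

(** * Divisibility properties of the levels *)

Section Divisibility.
Variable q : nat -> nat.
Hypothesis q_gt0 : forall n, (0 < q n)%N.
Hypothesis q_primes : forall p n, prime p -> (p %| q n)%N ->
  forall N, exists2 m, (N <= m)%N & (p %| q m)%N.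

Lemma level_gt0 n : (0 < level q n)%N.
Proof. by rewrite prodn_gt0. Qed.

Lemma coprime_level h n : (forall n, coprime h (q n)) -> coprime h (level q n).
Proof.
move=> hq; elim: n => [|n IHn]; first by rewrite /level big_ord0 coprimen1.
by rewrite level_recr coprimeMr IHn hq.
Qed.

Lemma prime_dvd_level p n : prime p -> (p %| level q n)%N -> exists m, (p %| q m)%N.
Proof.
move=> pp; elim: n => [|n IHn].
  by rewrite /level big_ord0 dvdn1 => /eqP p1; rewrite p1 in pp.
by rewrite level_recr Euclid_dvdM // => /orP[//|pq]; exists n.
Qed.

(** The primes of [u] are absorbed one at a time: each divides some [q n], hence also some [q m]
    beyond any level already reached. *)
Lemma level_absorb u b N : (u %| level q b)%N -> exists M, (u * level q N %| level q M)%N.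
Proof.
move: u {2}u (leqnn u) => u; move=> c; elim: c u => [|c IHc] u uc ub.
  by move: ub; move: uc; rewrite leqn0 => /eqP ->; rewrite dvd0n -leqn0 leqNgt level_gt0.
have u0 : (0 < u)%N by apply: dvdn_gt0 ub; exact: level_gt0.
have [u1|u1] := leqP u 1.
  by exists N; rewrite (_ : u = 1%N) ?mul1n //; lia.
have pp := pdiv_prime u1; have pu := pdiv_dvd u.
have [M uM] : exists M, (u %/ pdiv u * level q N %| level q M)%N.
  apply: IHc; last by apply: dvdn_trans ub; exact: dvdn_div.
  by rewrite -ltnS; apply: leq_trans uc; apply: ltn_Pdiv => //; exact: prime_gt1.
have [n pq] := prime_dvd_level pp (dvdn_trans pu ub).
have [m Mm pm] := q_primes pp pq M.
exists m.+1; rewrite level_recr -[in X in (X %| _)%N](divnK pu) mulnAC dvdn_mul //.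
exact: dvdn_trans (level_dvd q Mm).
Qed.

(** As long as [F] shares a prime with some [q n], that prime is moved into [F1]; [level_absorb]
    keeps [F1] below a level. *)
Lemma coprime_split F : (0 < F)%N -> exists F1 F2 b,
  [/\ F = (F1 * F2)%N, (F1 %| level q b)%N & forall n, coprime F2 (q n)].
Proof.
move: F {2}F (leqnn F) => F; move=> c; elim: c F => [|c IHc] F Fc F0; first by lia.
have [cF|/existsNP[n /negP nF]] := pselect (forall n, coprime F (q n)).
  by exists 1%N, F, 0%N; rewrite mul1n dvd1n.
have g1 : (1 < gcdn F (q n))%N by rewrite ltn_neqAle eq_sym nF gcdn_gt0 F0.
set p := pdiv (gcdn F (q n)); have pp : prime p by exact: pdiv_prime.
have pF : (p %| F)%N by apply: dvdn_trans (pdiv_dvd _) _; exact: dvdn_gcdl.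
have pq : (p %| q n)%N by apply: dvdn_trans (pdiv_dvd _) _; exact: dvdn_gcdr.
have [||F1 [F2 [b [FE F1b F2q]]]] := IHc (F %/ p)%N.
- by rewrite -ltnS; apply: leq_trans Fc; apply: ltn_Pdiv => //; exact: prime_gt1.
- by rewrite divn_gt0 ?prime_gt0 //; exact: dvdn_leq.
have [M pM] : exists M, (p * level q b %| level q M)%N.
  by apply: (@level_absorb p n.+1 b); rewrite level_recr dvdn_mull.
exists (p * F1)%N, F2, M; split=> //; first by rewrite -mulnA -FE mulnC divnK.
by apply: dvdn_trans pM; exact: dvdn_mul.
Qed.

End Divisibility.

(** * Orbit closures under powers of the shift *)

Section SubshiftDynamics.
Variable A : finType.
Implicit Types (x y z : full_shift A) (k l : int) (L N : nat).

Definition translate k x : full_shift A := fun i => x (i + k).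

Definition agree L x y := forall i : int, (`|i| <= L)%N -> x i = y i.

Lemma translate0 x : translate 0 x = x.
Proof. by apply/funext => i; rewrite /translate addr0. Qed.

Lemma translateD k l x : translate (k + l) x = translate k (translate l x).
Proof. by apply/funext => i; rewrite /translate addrA. Qed.

Lemma left_shiftE x : left_shift x = translate 1 x.
Proof. by []. Qed.

Lemma iter_left_shiftE n x : iter n (@left_shift A) x = translate n x.
Proof.
elim: n => [|n IHn]; first by rewrite translate0.
by rewrite iterS IHn left_shiftE -translateD -intS.
Qed.

Lemma agree_sym L x y : agree L x y -> agree L y x.
Proof. by move=> xy i iL; rewrite xy. Qed.

Lemma agree_trans L x y z : agree L x y -> agree L y z -> agree L x z.
Proof. by move=> xy yz i iL; rewrite xy ?yz. Qed.

Lemma agree_leq L L' x y : (L <= L')%N -> agree L' x y -> agree L x y.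
Proof. by move=> LL' xy i iL; apply: xy; exact: leq_trans LL'. Qed.

Lemma agree_translate L k x y :
  agree (L + `|k|)%N x y -> agree L (translate k x) (translate k y).
Proof. by move=> xy i iL; apply: xy; lia. Qed.

(* [y] is in the closure of the orbit of [x] under the [N]-th power of the shift. *)
Definition orbit_closure N x y := forall L, exists k, agree L (translate (N%:Z * k) x) y.

Lemma orbit_closure_refl N x : orbit_closure N x x.
Proof. by move=> L; exists 0; rewrite mulr0 translate0. Qed.

Lemma orbit_closure_trans N x y z :
  orbit_closure N x y -> orbit_closure N y z -> orbit_closure N x z.
Proof.
move=> xy yz L; have [k yk] := yz L.
have [l xl] := xy (L + absz (N%:Z * k)%R)%N.
exists (k + l); rewrite mulrDr translateD; apply: agree_trans yk.
exact: agree_translate.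
Qed.

Lemma orbit_closure_translate N k x y :
  orbit_closure N x y -> orbit_closure N (translate k x) (translate k y).
Proof.
move=> xy L; have [l xl] := xy (L + `|k|)%N; exists l.
by rewrite -translateD addrC translateD; exact: agree_translate.
Qed.

Lemma orbit_closure_mul N k x : orbit_closure N x (translate (N%:Z * k) x).
Proof. by move=> L; exists k. Qed.

Lemma orbit_closure_mulV N k x : orbit_closure N (translate (N%:Z * k) x) x.
Proof.
by move=> L; exists (- k); rewrite -translateD mulrN addNr translate0.
Qed.

End SubshiftDynamics.

Section MinimalSubshift.
Variables (A : finType) (X : set (full_shift A)).
Implicit Types (x y z : full_shift A) (k l : int) (L N : nat).

Hypothesis X_translate : forall k x, X x -> X (translate k x).
Hypothesis X_dense : forall x y, X x -> X y ->
  forall L, exists k, agree L (translate k x) y.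
Hypothesis X_compact : forall u : nat -> full_shift A, (forall n, X (u n)) ->
  exists2 x, X x & forall L, exists2 n, (L <= n)%N & agree L (u n) x.

(** The orbit of [x] approximates [y], and it splits into [N] orbits of the [N]-th power; one
    residue class must serve for every window. *)
Lemma orbit_closure_residue N x y : (0 < N)%N -> X x -> X y ->
  exists j : 'I_N, orbit_closure N x (translate (- (j : nat)%:Z) y).
Proof.
move=> N0 Xx Xy.
have [|L|j jP] := @antitone_pigeonhole N
  (fun j L => exists k, agree L (translate (N%:Z * k + j%:Z) x) y).
- by move=> j l l' ll' [k xk]; exists k; exact: agree_leq ll' xk.
- have [k xk] := X_dense Xx Xy L.
  have jN : (`|(k %% N)%Z| < N)%N by lia.
  exists (Ordinal jN), (k %/ N)%Z => /=.
  suff <- : k = N%:Z * (k %/ N)%Z + `|(k %% N)%Z|%N%:Z by [].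
  by rewrite gez0_abs ?modz_ge0; lia.
exists j => L; have [k xk] := jP (L + j)%N; exists k.
have -> : N%:Z * k = - (j : nat)%:Z + (N%:Z * k + (j : nat)%:Z).
  by rewrite addrCA addNr addr0.
by rewrite translateD; apply: agree_translate; apply: agree_leq xk; lia.
Qed.

(* Some translate of [x] is in the closure of the orbit of [y], so [y] is related to
   its own translate by the same amount [k]; iterating [N - 1] times, [k] becomes a
   multiple of [N]. *)
Lemma orbit_closure_sym N x y : (0 < N)%N -> X x -> X y ->
  orbit_closure N x y -> orbit_closure N y x.
Proof.
move=> N0 Xx Xy xy; have [j yk'] := orbit_closure_residue N0 Xy Xx.
move: yk'; set k := - _ => yk.
have yky : orbit_closure N y (translate k y).
  by apply: orbit_closure_trans yk _; exact: orbit_closure_translate.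
have kn (n : nat) : orbit_closure N y (translate (k * n) y).
  elim: n => [|n IHn]; first by rewrite mulr0 translate0; exact: orbit_closure_refl.
  apply: orbit_closure_trans yky _; rewrite (_ : k * n.+1 = k + k * n); last lia.
  by rewrite translateD; exact: orbit_closure_translate.
have := orbit_closure_translate (k * N.-1) yk.
rewrite -translateD (_ : k * N.-1 + k = N%:Z * k); last first.
  by rewrite mulrC -[X in _ + X]mul1r -mulrDl; congr (_ * _); lia.
move=> /(orbit_closure_trans (kn N.-1)) /orbit_closure_trans; apply.
exact: orbit_closure_mulV.
Qed.

(* For a minimal [X], the [N]-th power of the shift has [d] minimal components. *)
Definition is_period N d := [/\ (0 < d)%N, (d %| N)%N &
  forall x k, X x -> orbit_closure N x (translate k x) <-> (d %| k)%Z].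

(** By transitivity and symmetry the return amounts [k] form a subgroup of the integers, and [d] is
    its least positive element. *)
Lemma period_exists N : (0 < N)%N -> X !=set0 -> exists d, is_period N d.
Proof.
move=> N0 [x0 Xx0].
pose P d := `[< (0 < d)%N /\ orbit_closure N x0 (translate d x0) >].
have PN : P N.
  by apply/asboolP; split => //; rewrite -[N in translate N]mulr1; exact: orbit_closure_mul.
have exP : exists d, P d by exists N.
case: (ex_minnP exP) => d /asboolP [d0 x0d] dmin.
have addP x k l : X x -> orbit_closure N x (translate k x) ->
    orbit_closure N x (translate l x) -> orbit_closure N x (translate (k + l) x).
  move=> Xx xk xl; apply: orbit_closure_trans xk _.
  by rewrite translateD; exact: orbit_closure_translate.
have oppP x k : X x -> orbit_closure N x (translate k x) ->
    orbit_closure N x (translate (- k) x).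
  move=> Xx xk; have := orbit_closure_translate (- k) xk.
  rewrite -translateD addNr translate0; apply: orbit_closure_sym => //; exact: X_translate.
have mulP x k l : X x -> orbit_closure N x (translate k x) ->
    orbit_closure N x (translate (k * l) x).
  move=> Xx xk; have natP (n : nat) : orbit_closure N x (translate (k * n) x).
    elim: n => [|n IHn]; first by rewrite mulr0 translate0; exact: orbit_closure_refl.
    by rewrite (_ : k * n.+1 = k * n + k); [exact: addP|lia].
  case: l => n; first exact: natP.
  by rewrite NegzE mulrN; apply: oppP => //; exact: natP.
have x0P k : orbit_closure N x0 (translate k x0) <-> (d %| k)%Z.
  split=> [x0k|/dvdzP [l ->]]; last by rewrite mulrC; exact: mulP.
  apply/dvdz_mod0P; apply: contrapT => /eqP kd0.
  have kd : (k %% d)%Z = `|(k %% d)%Z|%N%:Z by rewrite gez0_abs ?modz_ge0; lia.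
  (* The remainder of a return modulo [d] is again a return, and it is smaller than [d]. *)
  suff /dmin : P `|(k %% d)%Z|%N by lia.
  apply/asboolP; split; first by lia.
  rewrite -kd (_ : (k %% d)%Z = k + - (d%:Z * (k %/ d)%Z)); last by lia.
  by apply: addP => //; apply: oppP => //; exact: mulP.
exists d; split => // [|x k Xx].
  suff /x0P : orbit_closure N x0 (translate N x0) by [].
  by rewrite -[N in translate N]mulr1; exact: orbit_closure_mul.
rewrite -x0P.
(* Some translate of [x] lies in the component of [x0]; as translations commute with the shift, both
   points have the same returns. *)
have [i xj'] := orbit_closure_residue N0 Xx0 Xx.
move: xj'; set j := - _ => xj.
have jx : orbit_closure N (translate j x) x0.
  by apply: orbit_closure_sym => //; exact: X_translate.
split=> xk.
  apply: orbit_closure_trans xj _; apply: orbit_closure_trans (orbit_closure_translate j xk) _.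
  by rewrite -translateD addrC translateD; exact: orbit_closure_translate.
have : orbit_closure N (translate j x) (translate k (translate j x)).
  apply: orbit_closure_trans jx _.
  by apply: orbit_closure_trans xk _; exact: orbit_closure_translate.
move/(orbit_closure_translate (- j)); rewrite -!translateD addNr translate0.
by rewrite addrAC addNr add0r.
Qed.

(** A Lebesgue number argument: pairs that agree on growing windows and violate [P] would accumulate
    at one point [z], where [locP] applies to both members. *)
Lemma uniform_on_agreement (P : full_shift A -> full_shift A -> Prop) :
  (forall z, X z -> exists L, forall x y, X x -> X y ->
     agree L z x -> agree L z y -> P x y) ->
  exists L, forall x y, X x -> X y -> agree L x y -> P x y.
Proof.
move=> locP; apply: contrapT => /forallNP noL.
have /choice [u uP] : forall L, exists xy : full_shift A * full_shift A,
    [/\ X xy.1, X xy.2, agree L xy.1 xy.2 & ~ P xy.1 xy.2].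
  move=> L; case/existsNP: (noL L) => x /existsNP[y].
  by move=> /not_implyP[Xx] /not_implyP[Xy] /not_implyP[xy nP]; exists (x, y).
have [|z Xz zP] := @X_compact (fun n => (u n).1); first by move=> n; case: (uP n).
have [L zL] := locP z Xz; have [n Ln unz] := zP L.
have [Xu1 Xu2 u12] := uP n; apply; apply: zL => //.
  exact: agree_sym.
by apply: agree_trans (agree_sym unz) _; exact: agree_leq u12.
Qed.

(** Components are closed and finite in number. If points outside the component of [z] came
    arbitrarily close to [z], one other component would contain such points for every window, and
    hence [z] itself. *)
Lemma orbit_closure_open N z : (0 < N)%N -> X z ->
  exists L, forall x, X x -> agree L z x -> orbit_closure N z x.
Proof.
move=> N0 Xz; apply: contrapT => /forallNP noL.
have [||j jP] := @antitone_pigeonhole N (fun j L => exists x,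
    [/\ X x, agree L z x, ~ orbit_closure N z x &
        orbit_closure N x (translate (- (j : nat)%:Z) z)]).
- by move=> j l l' ll' [x [? zx ? ?]]; exists x; split=> //; exact: agree_leq zx.
- move=> L; case/existsNP: (noL L) => x /not_implyP[Xx] /not_implyP[zx nzx].
  by have [j xj] := orbit_closure_residue N0 Xx Xz; exists j, x.
have jz : orbit_closure N (translate (- (j : nat)%:Z) z) z.
  move=> L; have [x [Xx zx _ xj]] := jP L.
  have [k jk] := orbit_closure_sym N0 Xx (X_translate _ Xz) xj L.
  by exists k; apply: agree_trans jk _; exact: agree_sym.
have [x [Xx _ nzx xj]] := jP 0%N; apply: nzx; apply: orbit_closure_sym => //.
exact: orbit_closure_trans xj jz.
Qed.

(* On a compact [X], continuity means dependence on a bounded window. *)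
Definition cyclic_map m (f : full_shift A -> cyclic_group m) :=
  (forall x k, X x -> f (translate k x) = f x + cyclic_one m *~ k) /\
  (exists L, forall x y, X x -> X y -> agree L x y -> f x = f y).

(** The value at [x] is the amount of shift that brings [x0] into the component of [x], well defined
    modulo [d] and so modulo [m]. Openness of the components bounds the window. *)
Lemma cyclic_map_exists N d m x0 : (0 < N)%N -> is_period N d -> (m %| d)%N ->
  X x0 -> exists2 f, @cyclic_map m f & f x0 = 0.
Proof.
move=> N0 [d0 dN dP] md Xx0; have m0 : (0 < m)%N by exact: dvdn_gt0 md.
(* On [X] a suitable [k] exists by [orbit_closure_residue], so the default [0] matters only outside
   [X]. *)
pose f x := cyclic_one m *~ xget 0 [set k | orbit_closure N x (translate k x0)].
have fP x k : X x -> orbit_closure N x (translate k x0) -> f x = cyclic_one m *~ k.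
  move=> Xx xk; rewrite /f; case: xgetP => [l _ /= xl|/(_ k)//].
  apply/eqP; rewrite -subr_eq0 -mulrzBr cyclic_one_mulz_eq0 //.
  apply: (@dvdz_trans d); first by rewrite dvdzE.
  apply/(dP _ _ Xx0); have : orbit_closure N (translate k x0) (translate l x0).
    by apply: orbit_closure_trans _ xl; apply: orbit_closure_sym => //; exact: X_translate.
  by move/(orbit_closure_translate (- k)); rewrite -!translateD addNr translate0 addrC.
have fE x : X x -> exists2 k, orbit_closure N x (translate k x0) & f x = cyclic_one m *~ k.
  move=> Xx; have [j xj] := orbit_closure_residue N0 Xx Xx0.
  by exists (- (j : nat)%:Z) => //; exact: fP.
exists f; last by rewrite (@fP _ 0) // translate0; exact: orbit_closure_refl.
split=> [x k Xx|].
  have [l xl ->] := fE x Xx; rewrite -mulrzDr addrC; apply: fP; first exact: X_translate.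
  by rewrite translateD; exact: orbit_closure_translate.
apply: (uniform_on_agreement (P := fun x y => f x = f y)) => z Xz.
have [L zL] := orbit_closure_open N0 Xz; have [k zk fz] := fE z Xz.
have fx x : X x -> agree L z x -> f x = f z.
  move=> Xx /(zL _ Xx) zx; rewrite fz; apply: fP => //; apply: orbit_closure_trans _ zk.
  exact: orbit_closure_sym.
by exists L => x y Xx Xy /(fx _ Xx) -> /(fx _ Xy) ->.
Qed.

(** The translate of [x] by [d] is approximated by translates by multiples of [N]. Comparing values
    of [f] gives [d] congruent to such a multiple modulo [m], hence to 0. *)
Lemma cyclic_map_dvd_period N d m (f : full_shift A -> cyclic_group m) :
  (0 < m)%N -> X !=set0 ->
  is_period N d -> cyclic_map f -> (m %| N)%N -> (m %| d)%N.
Proof.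
move=> m0 [x Xx] [d0 dN dP] [fT [L fL]] mN.
have xd : orbit_closure N x (translate d x) by apply/dP => //; exact: dvdzz.
have [k xk] := xd L.
have /eqP := fL _ _ (X_translate _ Xx) (X_translate _ Xx) xk.
rewrite !fT // -subr_eq0 opprD addrACA subrr add0r -mulrzBr cyclic_one_mulz_eq0 //.
have mNk : (m %| N%:Z * k)%Z by rewrite dvdz_mulr // dvdzE.
by rewrite (rpredBl _ mNk) dvdzE.
Qed.

(** A cyclic map of order [d] separates the [d] components: the component of [x] contains some
    translate of [y], and equal values force the amount of translation to be a multiple of [d]. *)
Lemma cyclic_map_orbit_closure N d (f : full_shift A -> cyclic_group d) x y :
  (0 < N)%N -> is_period N d -> cyclic_map f -> X x -> X y -> f x = f y ->
  orbit_closure N x y.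
Proof.
move=> N0 [d0 dN dP] [fT [L fL]] Xx Xy fxy.
have [j xj] := orbit_closure_residue N0 Xx Xy; move: xj; set l := - _ => xl.
have [k xk] := xl L; have /eqP := fL _ _ (X_translate _ Xx) (X_translate _ Xy) xk.
rewrite !fT // fxy -subr_eq0 opprD addrACA subrr add0r -mulrzBr cyclic_one_mulz_eq0 //.
have dNk : (d %| N%:Z * k)%Z by rewrite dvdz_mulr // dvdzE.
rewrite (rpredBl _ dNk) => /(dP _ _ Xy) yl; apply: orbit_closure_trans xl _.
by apply: orbit_closure_sym => //; exact: X_translate.
Qed.

(** Approximate [y] by [translate k x] on a window that determines all three maps; then [m] and [m']
    divide [k], hence so does [d]. *)
Lemma cyclic_map_factor m m' d (f : full_shift A -> cyclic_group m)
    (f' : full_shift A -> cyclic_group m') (g : full_shift A -> cyclic_group d) x y :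
  (0 < m)%N -> (0 < m')%N -> (0 < d)%N ->
  (forall k, (m %| k)%Z -> (m' %| k)%Z -> (d %| k)%Z) ->
  cyclic_map f -> cyclic_map f' -> cyclic_map g -> X x -> X y ->
  f x = f y -> f' x = f' y -> g x = g y.
Proof.
move=> m0 m'0 d0 dP [fT [L fL]] [fT' [L' fL']] [gT [L'' gL]] Xx Xy fxy fxy'.
have [k xk] := X_dense Xx Xy (maxn L (maxn L' L'')).
have /eqP := fL _ _ (X_translate _ Xx) Xy (agree_leq (leq_maxl _ _) xk).
have /eqP := fL' _ _ (X_translate _ Xx) Xy (agree_leq (leq_trans (leq_maxl _ _) (leq_maxr _ _)) xk).
rewrite fT // fT' // fxy fxy' -[X in _ == X]addr0 (inj_eq (addrI _)) cyclic_one_mulz_eq0 //.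
move=> m'k; rewrite -[X in _ == X]addr0 (inj_eq (addrI _)) cyclic_one_mulz_eq0 // => mk.
rewrite -(gL _ _ (X_translate _ Xx) Xy (agree_leq (leq_trans (leq_maxr _ _) (leq_maxr _ _)) xk)).
by rewrite gT //; move/eqP: (dP k mk m'k); move: (dP k mk m'k);
  rewrite -cyclic_one_mulz_eq0 // => /eqP ->; rewrite addr0.
Qed.

(** The property shared by equicontinuous factor maps and continuous eigenfunctions. It is stated on
    the subshift alone, so both are treated at once without a map acting on [V]. *)
Definition orbit_equicontinuous (V : uniformType) (phi : full_shift A -> V) :=
  forall (E : set (V * V)) z, entourage E -> X z ->
    exists L, forall x, X x -> agree L z x ->
      forall k, E (phi (translate k z), phi (translate k x)).

Lemma orbit_equicontinuous_uniform (V : uniformType) (phi : full_shift A -> V) E :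
  orbit_equicontinuous phi -> entourage E ->
  exists L, forall x y, X x -> X y -> agree L x y ->
    forall k, E (phi (translate k x), phi (translate k y)).
Proof.
move=> phi_eq entE; apply: uniform_on_agreement => z Xz.
pose E' := split_ent E.
have entE' : entourage (E' `&` E'^-1)%relation by apply: entourage_invI; exact: entourage_split_ent.
have [L zL] := phi_eq _ _ entE' Xz.
exists L => x y Xx Xy zx zy k; apply: (entourage_split (phi (translate k z))) => //.
  by have [] := zL x Xx zx k.
by have [] := zL y Xy zy k.
Qed.

End MinimalSubshift.

(** * Topology of the full shift in terms of windows *)

Section FullShiftTopology.
Variable A : finType.
Implicit Types (x y z : full_shift A) (k l : int) (L N : nat).

Lemma nbhs_full_shift x (B : set (full_shift A)) :
  nbhs x B <-> exists L, forall y, agree L x y -> B y.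
Proof.
split.
  case/(@nbhs_prod_discrete int (fun=> discrete_topology A) x B) => s sB.
  exists (\max_(i <- s) `|i|)%N => y xy; apply: sB => i si.
  by apply/esym/xy; exact: leq_bigmax_seq.
case=> L xB; apply/(@nbhs_prod_discrete int (fun=> discrete_topology A) x B).
exists ([seq Posz n | n <- iota 0 L.+1] ++ [seq - Posz n | n <- iota 0 L.+1]).
move=> y yx; apply: xB => i iL; apply/esym/yx; rewrite mem_cat.
have nL : `|i|%N \in iota 0 L.+1 by rewrite mem_iota.
have [i0|i0] := leP 0 i; apply/orP; [left|right]; apply/mapP; exists `|i|%N => //; lia.
Qed.

Lemma closed_full_shift (F : set (full_shift A)) :
  (forall y, (forall L, exists2 x, F x & agree L x y) -> F y) -> closed F.
Proof.
move=> Fcl y Fy; apply: Fcl => L.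
have /Fy [x [Fx yx]] : nbhs y [set x | agree L y x] by apply/nbhs_full_shift; exists L.
by exists x => //; exact: agree_sym.
Qed.

Lemma full_shift_accumulation (u : nat -> full_shift A) :
  exists x, forall L, exists2 n, (L <= n)%N & agree L (u n) x.
Proof.
have cA : compact [set: discrete_topology A] by apply: finite_compact; exact: finite_finset.
have := tychonoff (fun _ : int => cA).
move=> /(_ (u @ \oo) _) []; first exact: filterS filterT.
move=> x [_ clx]; exists x => L.
have un : (u @ \oo) [set y | exists2 n, (L <= n)%N & y = u n].
  by exists L => // n /= Ln; exists n.
have xL : nbhs x [set y | agree L x y] by apply/nbhs_full_shift; exists L.
have [y [[n Ln ->] yx]] := clx _ _ un xL.
by exists n => //; exact: agree_sym.
Qed.

(** The orbit closure of [x] is a non-empty closed invariant subset of [X], so it is all of [X]. *)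
Lemma minimal_dense (X : set (full_shift A)) x y :
  (forall y, (forall L, exists2 x, X x & agree L x y) -> X y) ->
  (forall k x, X x -> X (translate k x)) ->
  minimal X (@left_shift A) -> X x -> X y ->
  forall L, exists k, agree L (translate k x) y.
Proof.
move=> Xcl X_translate [_ Xmin] Xx.
pose F := [set y | forall L, exists k, agree L (translate k x) y].
have Fx : F x by move=> L; exists 0; rewrite translate0.
have FT k z : F z -> F (translate k z).
  move=> Fz L; have [l zl] := Fz (L + `|k|)%N.
  by exists (k + l); rewrite translateD; exact: agree_translate.
have [|||F0|FX] := Xmin F.
- apply: closed_full_shift => z Fz L; have [t Ft tz] := Fz L.
  by have [k kt] := Ft L; exists k; exact: agree_trans kt tz.
- move=> z Fz; apply: Xcl => L; have [k kz] := Fz L.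
  by exists (translate k x) => //; exact: X_translate.
- apply/seteqP; split=> [_ [z Fz <-]|z Fz]; first exact: FT.
  exists (translate (-1) z); first exact: FT.
  by rewrite left_shiftE -translateD addrN translate0.
- by move: Fx; rewrite F0.
- by rewrite -FX.
Qed.

End FullShiftTopology.

(** * Cutting points of an S-adic shift into blocks *)

Section Compose.
Variables (A : nat -> finType) (theta : directive_sequence A) (q : nat -> nat).
Hypothesis theta_q : constant_length theta q.

(* The index [k + 0] is forced by the type of [compose]. *)
Lemma size_compose k (a : A (k + 0)%N) : size (compose theta a) = level q k.
Proof.
elim: k a => [|k IHk] a; first by rewrite /level big_ord0.
rewrite /= (@size_flatten_uniform _ (level q k)) => [|i].
  by rewrite size_map theta_q addn0 level_recr.
rewrite size_map; case: (theta (k + 0)%N a) => // b0 s i_s.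
by rewrite (nth_map b0).
Qed.

(** The word [s] arises from [a] by the [d] morphisms above level [n]. *)
Lemma compose_blocks d n (a : A (d + n + 0)%N) :
  exists s : seq (A (n + 0)%N),
    compose theta a = flatten [seq compose theta b | b <- s].
Proof.
elim: d a => [|d IHd] a; first by exists [:: a]; rewrite /= cats0.
have /choice [f fP] := IHd.
exists (flatten [seq f b | b <- theta (d + n + 0)%N a]) => /=.
elim: (theta _ a) => [//|b s IHs] /=.
by rewrite map_cat flatten_cat -IHs fP.
Qed.

End Compose.

Lemma size_subword (A : finType) (x : full_shift A) i l : size (subword x i l) = l.
Proof. by rewrite size_map size_iota. Qed.

Lemma nth_subword (A : finType) c0 (x : full_shift A) i l t : (t < l)%N ->
  nth c0 (subword x i l) t = x (i + t%:Z).
Proof. by move=> tl; rewrite (nth_map 0%N) ?size_iota // nth_iota. Qed.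

Lemma prefix_subword (A : finType) (x : full_shift A) i l l' : (l <= l')%N ->
  prefix (subword x i l) (subword x i l').
Proof.
move=> ll'; rewrite prefixE; apply/eqP/(@eq_from_nth _ (x 0)).
  by rewrite size_takel ?size_subword.
move=> t; rewrite size_takel ?size_subword // => tl.
by rewrite nth_take // !nth_subword // (leq_trans tl).
Qed.

Section SadicShift.
Variables (A : nat -> finType) (theta : directive_sequence A) (q : nat -> nat).
Hypothesis theta_q : constant_length theta q.
Local Notation X := (S_adic_shift theta 0%N).
Implicit Types (x y z : full_shift (A 0%N)) (k l : int) (L N n : nat).

Lemma S_adic_shift_translate k x : X x -> X (translate k x).
Proof.
move=> Xx i n; have [m [a xa]] := Xx (i + k) n; exists m, a.
rewrite (_ : subword _ _ _ = subword x (i + k) n) //.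
by apply: eq_map => j; rewrite /translate addrAC.
Qed.

Lemma S_adic_shift_closed y :
  (forall L, exists2 x, X x & agree L x y) -> X y.
Proof.
move=> Xy i n; have [x Xx xy] := Xy (`|i| + n)%N.
have [m [a xa]] := Xx i n; exists m, a.
rewrite (_ : subword _ _ _ = subword x i n) //.
apply/eq_in_map => j; rewrite mem_iota => jn; apply/esym/xy; lia.
Qed.

(** Images of letters from the levels up to [n.+1] have length at most [B], so a window of length
    greater than [B] occurs only in the image of a deeper letter. Its prefix of length [l] is then
    kept. *)
Lemma S_adic_shift_deep x i (l n : nat) : X x ->
  exists m (a : A (m.+1 + 0)%N), (n < m)%N /\ infix (subword x i l) (compose theta a).
Proof.
move=> Xx; pose B := (\max_(j < n.+2) level q j)%N.
have [m [a xa]] := Xx i (maxn l B.+1); exists m, a; split.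
  rewrite ltnNge; apply/negP => mn.
  have := size_infix xa; rewrite size_subword (size_compose theta_q) => /(leq_trans (leq_maxr _ _)).
  have mn2 : (m.+1 < n.+2)%N by [].
  by rewrite ltnNge (@leq_bigmax _ (fun j : 'I_n.+2 => level q j) (Ordinal mn2)).
exact: infix_trans (prefixW (prefix_subword _ _ (leq_maxl _ _))) xa.
Qed.

(** A one-letter subword occurs in an image whose length is a product with [q n] among its
    factors. *)
Lemma length_gt0 n : X !=set0 -> (0 < q n)%N.
Proof.
move=> [x Xx]; have [m [a [nm xa]]] := S_adic_shift_deep 0 1 n Xx.
have := size_infix xa; rewrite size_subword (size_compose theta_q).
have nm1 : (n < m.+1)%N by exact: ltnW.
by rewrite /level (bigD1 (Ordinal nm1)) //= muln_gt0 => /andP[].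
Qed.

(** Every window of [x] sits in a long image, which is a concatenation of blocks of length [P]. The
    phase of the cutting may depend on the window, but one phase recurs for all windows. *)
Lemma S_adic_cutting x n : X x -> exists (j : int) (g : int -> A (n + 0)%N),
  forall i (t : nat), (t < level q n)%N ->
    x (j + (level q n)%:Z * i + t%:Z) = nth (x 0 : A 0%N) (compose theta (g i)) t.
Proof.
move=> Xx; set P := level q n.
have P0 : (0 < P)%N by rewrite prodn_gt0 // => i; apply: length_gt0; exists x.
have [|L|j jP] := @antitone_pigeonhole P (fun j L => forall i : int,
    - L%:Z <= (j : nat)%:Z + P%:Z * i -> (j : nat)%:Z + P%:Z * i + P%:Z <= L%:Z + 1 ->
    exists b : A (n + 0)%N, forall t : nat, (t < P)%N ->
      x ((j : nat)%:Z + P%:Z * i + t%:Z) = nth (x 0 : A 0%N) (compose theta b) t).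
- by move=> j L L' LL' jP i iL iL'; apply: jP; lia.
- have [m [a [nm]]] := S_adic_shift_deep (- L%:Z) (2 * L).+1 n Xx.
  have dE : m.+1 = (m.+1 - n + n)%N by rewrite subnK // ltnW // ltnW.
  move: (m.+1 - n)%N dE a => d dE; rewrite dE => a {dE nm m} /infixP [p [p' aE]].
  have [s sE] := compose_blocks theta a.
  (* Coordinate [v] of [x] is position [size p + L + v] in the image of [a]. Blocks start at the
     multiples of [P] there, that is, at the [v] congruent to [r]. *)
  pose r := - ((size p)%:Z + L%:Z).
  have rP : (`|(r %% P)%Z| < P)%N.
    by rewrite -ltz_nat gez0_abs ?modz_ge0 ?ltz_pmod //; lia.
  have r0 : 0 <= (r %% P)%Z by apply: modz_ge0; lia.
  exists (Ordinal rP) => /= i; rewrite gez0_abs //.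
  set v := _ + P%:Z * i => vL vL'.
  have tauE : L%:Z + v = (`|(L%:Z + v)%R|%N)%:Z by rewrite gez0_abs //; lia.
  move: `|_|%N tauE => tau tauE.
  have tauP : (tau + P <= (2 * L).+1)%N by lia.
  have [i' i'E] : exists i' : nat, (size p + tau = P * i')%N.
    exists `|(i - (r %/ P)%Z)%R|%N.
    have pE : (size p)%:Z + tau%:Z = P%:Z * (i - (r %/ P)%Z).
      by rewrite -tauE /v; have := divz_eq r P; rewrite /r; lia.
    have i0 : 0 <= i - (r %/ P)%Z by rewrite -(pmulr_rge0 _ (_ : 0 < P%:Z)) -?pE.
    by apply/eqP; rewrite -eqz_nat PoszD PoszM gez0_abs // pE.
  have szs (c : nat) : (c < size [seq compose theta b | b <- s])%N ->
      size (nth [::] [seq compose theta b | b <- s] c) = P.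
    rewrite size_map; case: (s) => // b0 s0 cs.
    by rewrite (nth_map b0) // (size_compose theta_q).
  (* The block ends inside the window, so its index does not run past [s]. *)
  have i's : (i' < size s)%N.
    have : size (compose theta a) = (P * size s)%N.
      by rewrite sE (size_flatten_uniform szs) size_map.
    rewrite aE !size_cat size_subword => szE.
    rewrite -(leq_pmul2l P0) mulnS -i'E -szE addnCA leq_add2l.
    by apply: leq_trans (leq_addr _ _); rewrite addnC.
  have b0 : A (n + 0)%N by case: (s) i's.
  exists (nth b0 s i') => t tP.
  rewrite -(nth_map b0 [::] _ i's) -(nth_flatten_uniform _ szs) ?size_map ?i's //.
  rewrite -sE aE -i'E -addnA; symmetry.
  have tauL : (tau + t < (2 * L).+1)%N by apply: leq_trans tauP; rewrite ltn_add2l.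
  apply: etrans (nth_cat_mid _ _ _ _) _; first by rewrite size_subword.
  by apply: etrans (nth_subword _ _ _ tauL) _; congr x; lia.
have /choice [g gP] : forall i : int, exists b : A (n + 0)%N, forall t : nat, (t < P)%N ->
      x ((j : nat)%:Z + P%:Z * i + t%:Z) = nth (x 0 : A 0%N) (compose theta b) t.
  (* The radius is chosen so that the whole block number [i] lies in the window. *)
  by move=> i; apply: (jP (absz ((j : nat)%:Z + P%:Z * i)%R + P)%N i); lia.
by exists (j : nat)%:Z, g.
Qed.

Lemma S_adic_compact (u : nat -> full_shift (A 0%N)) : (forall n, X (u n)) ->
  exists2 x, X x & forall L, exists2 n, (L <= n)%N & agree L (u n) x.
Proof.
move=> Xu; have [x xP] := full_shift_accumulation u; exists x => //.
by apply: S_adic_shift_closed => L; have [n _ unx] := xP L; exists (u n).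
Qed.

Hypothesis X_minimal : minimal X (@left_shift (A 0%N)).

Lemma S_adic_dense x y : X x -> X y -> forall L, exists k, agree L (translate k x) y.
Proof.
by apply: minimal_dense => //; [exact: S_adic_shift_closed|exact: S_adic_shift_translate].
Qed.

Lemma level_unbounded B : X !=set0 -> (forall N, exists2 n, (N <= n)%N & (1 < q n)%N) ->
  exists n, (B <= level q n)%N.
Proof.
move=> X0 growth; elim: B => [|B [n Bn]]; first by exists 0%N.
have [m nm qm] := growth n; exists m.+1; rewrite level_recr.
have lm0 : (0 < level q m)%N by rewrite prodn_gt0 // => i; exact: length_gt0.
apply: (leq_ltn_trans Bn); apply: leq_ltn_trans (dvdn_leq lm0 (level_dvd q nm)) _.
by rewrite -[X in (X < _)%N]muln1 ltn_pmul2l.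
Qed.

(** * Almost periods, and the bound on the number of components *)

(** Agreement on one window yields closeness along whole orbits, so a return between two equal
    blocks can be repeated from any position. Repeating it [K! / r] times gives a return independent
    of the point. *)
Lemma almost_period (V : uniformType) (phi : full_shift (A 0%N) -> V) E K :
  (forall N, exists2 n, (N <= n)%N & (1 < q n)%N) -> (forall n, #|A n| <= K)%N ->
  orbit_equicontinuous X phi -> entourage E ->
  exists n, forall x m k, X x ->
    E (phi (translate k x), phi (translate (k + (level q n * K`!)%N%:Z * m) x)).
Proof.
move=> growth AK phi_eq entE.
have [E' entE' chainE'] := entourage_chain K`! entE.
have [x0|/existsNP[x0 /contrapT Xx0]] := pselect (forall x, ~ X x).
  by exists 0%N => x m k /x0.
have X0 : X !=set0 by exists x0.
have [L LP] := orbit_equicontinuous_uniform S_adic_compact phi_eq entE'.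
(* A block of this length contains a window of radius [L]; the points [y r] below are centred in
   their blocks, whence the shift by [L]. *)
have [n nL] := level_unbounded (2 * L).+1 X0 growth; exists n => x m k Xx.
have [j [g gP]] := S_adic_cutting n Xx.
(* The multiple [m * (r2 - r1)] of the spacing is a return; [r2 - r1] depends on [x]
   and [m] but divides [K!]. *)
have [r1 [r2 [r12 r2K gr]]] := pigeonhole_seq (fun r => g (m * r%:Z)) (AK (n + 0)%N).
set P := level q n in nL gP *.
pose y (r : nat) := translate (j + P%:Z * (m * r%:Z) + L%:Z) x.
have yE r i : (`|i| <= L)%N ->
    y r i = nth (x 0 : A 0%N) (compose theta (g (m * r%:Z))) `|(i + L%:Z)%R|%N.
  move=> iL; rewrite -gP; last by lia.
  by rewrite /y /translate gez0_abs; [congr x|]; lia.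
have y12 : agree L (y r1) (y r2) by move=> i iL; rewrite !yE // gr.
pose r := (r2 - r1)%N; have r0 : (0 < r)%N by rewrite subn_gt0.
have rK : (r %| K`!)%N by apply: dvdn_fact; rewrite r0 (leq_trans (leq_subr _ _) r2K).
pose u (i : nat) := phi (translate (k + P%:Z * (m * (r * i)%N%:Z)) x).
have uE i : E' (u i, u i.+1).
  (* Translating by [l] carries the pair of equal blocks to the [i]-th link of the chain. *)
  pose l := k + P%:Z * (m * (r * i)%N%:Z) - (j + P%:Z * (m * r1%:Z) + L%:Z).
  have := LP _ _ (S_adic_shift_translate _ Xx) (S_adic_shift_translate _ Xx) y12 l.
  rewrite /y -!translateD (_ : l + (j + P%:Z * (m * r2%:Z) + L%:Z) =
    k + P%:Z * (m * (r * i.+1)%N%:Z)); first by rewrite subrK.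
  have -> : r2 = (r1 + r)%N by rewrite subnKC // ltnW.
  by rewrite /l mulnS !PoszD; ring.
have := chainE' u uE (K`! %/ r)%N (leq_div _ _).
rewrite /u muln0 !mulr0 addr0 [in (r * _)%N]mulnC divnK // PoszM.
by rewrite (mulrC m) mulrA.
Qed.

(** Otherwise blocks overlap so much that equality of two of them, at distance [r * d], propagates
    over a stretch of length [K! * d] and gives the common period [K! * d] at every coordinate. *)
Lemma period_bound K n d : aperiodic X -> X !=set0 -> (forall n, #|A n| <= K)%N ->
  is_period X (level q n) d -> (level q n %/ d <= K`! + K)%N.
Proof.
move=> aper [x0 Xx0] AK [d0 dP dper]; rewrite leqNgt; apply/negP => cK.
have [j [g gP]] := S_adic_cutting n Xx0.
pose y := translate j x0; have Xy : X y by exact: S_adic_shift_translate.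
have /choice [b bP] : forall i : int, exists b : A (n + 0)%N, forall t : nat,
    (t < level q n)%N -> y (d%:Z * i + t%:Z) = nth (x0 0 : A 0%N) (compose theta b) t.
  move=> i; have ydi : orbit_closure (level q n) y (translate (d%:Z * i) y).
    by apply/dper => //; exact: dvdz_mulr.
  (* The translate by [d * i] is in the component of [y], so near the origin it looks like a
     translate of [y] by a multiple of [level q n], where a block starts. *)
  have [k yk] := ydi (level q n); exists (g k) => t tn; rewrite -gP //.
  have := yk t%:Z (ltnW tn); rewrite /y /translate => /esym.
  by rewrite [d%:Z * i + _]addrC => ->; congr x0; ring.
apply: (aper y (K`! * d)%N Xy); first by rewrite muln_gt0 fact_gt0.
rewrite iter_left_shiftE; apply/funext => s; rewrite /translate.
(* Starting [K] multiples of [d] before [s] ensures that both equal blocks begin at or before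
   [s]. *)
pose i0 := (s %/ d)%Z - K%:Z.
have [r1 [r2 [r12 r2K br]]] := pigeonhole_seq (fun r => b (i0 + r%:Z)) (AK (n + 0)%N).
pose r := (r2 - r1)%N; have r0 : (0 < r)%N by rewrite subn_gt0.
have rK : (r %| K`!)%N by apply: dvdn_fact; rewrite r0 (leq_trans (leq_subr _ _) r2K).
have yr (v : nat) : (v < level q n)%N ->
    y (d%:Z * (i0 + r1%:Z) + v%:Z + (r * d)%N%:Z) = y (d%:Z * (i0 + r1%:Z) + v%:Z).
  move=> vn; rewrite [RHS]bP // br -bP //; congr y.
  have -> : r2 = (r1 + r)%N by rewrite subnKC // ltnW.
  by rewrite PoszD PoszM !mulrDr; lia.
have [w [ws wd]] : exists w : nat, s = d%:Z * (i0 + r1%:Z) + w%:Z /\ (w < K.+1 * d)%N.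
  exists ((K - r1) * d + `|(s %% d)%Z|)%N.
  have sd0 : 0 <= (s %% d)%Z by apply: modz_ge0; lia.
  have sd : (`|(s %% d)%Z| < d)%N by rewrite -ltz_nat gez0_abs // ltz_pmod.
  split; last by rewrite mulSn addnC -addSn leq_add // leq_mul2r leq_subr orbT.
  rewrite PoszD gez0_abs // [LHS](divz_eq s d) /i0 PoszM -subzn; last by lia.
  by ring.
(* Each step advances by [r * d]. The offset from the start of the first block stays below
   [(K.+1 + K!) * d], hence inside the block by [cK]. *)
suff ys c : (c * r <= K`!)%N -> y (s + (c * r * d)%N%:Z) = y s.
  by have := ys (K`! %/ r)%N; rewrite divnK // => ->.
elim: c => [|c IHc] cr; first by rewrite mul0n addr0.
have cr' : (c * r + r <= K`!)%N by rewrite addnC -mulSn.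
rewrite -IHc; last by apply: leq_trans cr'; exact: leq_addr.
have := yr (w + c * r * d)%N; rewrite PoszD addrA -ws mulSn mulnDl PoszD.
rewrite [X in _ -> y X = _](_ : _ = s + (c * r * d)%N%:Z + (r * d)%N%:Z) //; last first.
  by rewrite -addrA [X in _ + X = _]addrC.
apply.
apply: (@leq_trans (K.+1 * d + c * r * d)); first by rewrite ltn_add2r.
rewrite -mulnDl -[X in (_ <= X)%N](divnK dP) leq_mul2r; apply/orP; right.
by apply: leq_trans cK; rewrite addSn ltnS addnC; apply: leq_add => //; lia.
Qed.

Section LevelPeriod.
Hypothesis q_gt0 : forall n, (0 < q n)%N.
Hypothesis q_primes : forall p n, prime p -> (p %| q n)%N ->
  forall N, exists2 m, (N <= m)%N & (p %| q m)%N.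

(** The cofactor [c] of [d] in [level q N] divides [level q b], with [b] independent of [N]. So if
    [level q N] is a multiple of [level q b * level q n], the factor [level q n] is left for [d]. *)
Lemma level_dvd_period C n : X !=set0 ->
  (forall N d, is_period X (level q N) d -> (level q N %/ d <= C)%N) ->
  exists N d, is_period X (level q N) d /\ (level q n %| d)%N.
Proof.
move=> X0 boundC; have [F1 [F2 [b [CE F1b F2q]]]] := coprime_split q_gt0 q_primes (fact_gt0 C).
have [N bnN] := level_absorb q_gt0 q_primes n (dvdnn (level q b)).
have [d dP] := period_exists S_adic_shift_translate S_adic_dense (level_gt0 q_gt0 N) X0.
exists N, d; split=> //; have [d0 dN _] := dP.
set c := (level q N %/ d)%N; have cdN : (c * d)%N = level q N by rewrite divnK.
have c0 : (0 < c)%N by rewrite divn_gt0 // dvdn_leq // level_gt0.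
have /dvdnP[e bE] : (c %| level q b)%N.
  (* Being at most [C], [c] divides [C!]; dividing [level q N], it is coprime to [F2]. *)
  apply: dvdn_trans F1b; rewrite -(@Gauss_dvdl c F1 F2).
    by rewrite -CE dvdn_fact // c0 boundC.
  by apply: coprime_dvdl (_ : c %| level q N)%N _; rewrite -?cdN ?dvdn_mulr // coprime_sym cdN coprime_level.
move: bnN; rewrite -cdN bE mulnAC mulnC dvdn_pmul2l //.
exact/dvdn_trans/dvdn_mull.
Qed.

End LevelPeriod.

End SadicShift.

(** * The cyclic factors of a torsion-free shift *)

Section TorsionFree.
Variables (A : nat -> finType) (theta : directive_sequence A) (q : nat -> nat).
Hypothesis tf : torsion_free theta q.
Variable (K : nat).
Hypothesis AK : forall n, (#|A n| <= K)%N.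
Local Notation X := (S_adic_shift theta 0%N).
Implicit Types (x y z : full_shift (A 0%N)).

Let theta_q : constant_length theta q := tf_constant_length tf.
Let X_minimal : minimal X (@left_shift (A 0%N)) := tf_minimal tf 0%N.
Let X0 : X !=set0 := X_minimal.1.
Let q_gt0 n : (0 < q n)%N. Proof. exact: (length_gt0 theta_q n X0). Qed.
Let X_translate := @S_adic_shift_translate A theta.
Let X_compact := @S_adic_compact A theta.
Let X_dense := S_adic_dense X_minimal.

Lemma period_torsion_free N : (0 < N)%N -> exists d, is_period X N d.
Proof. by move=> N0; exact: period_exists. Qed.

Lemma cyclic_map_level n x0 : X x0 ->
  exists2 F : full_shift (A 0%N) -> cyclic_group (level q n), cyclic_map X F & F x0 = 0.
Proof.
move=> Xx0; have bound N d (dP : is_period X (level q N) d) :=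
  period_bound theta_q (tf_aperiodic tf) X0 AK dP.
have [N [d [dP nd]]] := level_dvd_period X_minimal q_gt0 (tf_primes tf) n X0 bound.
exact: (cyclic_map_exists X_translate X_dense X_compact (level_gt0 q_gt0 N) dP nd Xx0).
Qed.

(** The last clause carries maximality: [phi] is constant up to [E] on the components of a power of
    the shift, and [F N] with [f] tells these components apart. *)
Lemma cyclic_structure x0 : X x0 ->
  exists (h : nat) (F : forall n, full_shift (A 0%N) -> cyclic_group (level q n))
    (f : full_shift (A 0%N) -> cyclic_group h),
  [/\ (0 < h)%N /\ forall n, coprime h (q n),
      forall n, cyclic_map X (F n) /\ F n x0 = 0,
      cyclic_map X f /\ f x0 = 0 &
      forall (V : uniformType) (phi : full_shift (A 0%N) -> V) E,
        orbit_equicontinuous X phi -> entourage E ->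
        exists N, forall x y, X x -> X y -> F N x = F N y -> f x = f y ->
          E (phi x, phi y)].
Proof.
move=> Xx0; have level0 := level_gt0 q_gt0.
have [K1 [K2 [b [KE K1b K2q]]]] := coprime_split q_gt0 (tf_primes tf) (fact_gt0 K).
have K20 : (0 < K2)%N by have := fact_gt0 K; rewrite KE muln_gt0 => /andP[].
have [h hP] := period_torsion_free K20; have [h0 hK2 _] := hP.
have hq n : coprime h (q n) by apply: coprime_dvdl hK2 _.
have [f fP fx0] := cyclic_map_exists X_translate X_dense X_compact K20 hP (dvdnn h) Xx0.
pose F n := s2val (cid2 (cyclic_map_level n Xx0)).
have FP n : cyclic_map X (F n) /\ F n x0 = 0.
  by rewrite /F; case: (cid2 (cyclic_map_level n Xx0)).
exists h, F, f; split=> // V phi E phi_eq entE.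
have entS : entourage (split_ent E) by exact: entourage_split_ent.
have [n nP] := almost_period theta_q (tf_growth tf) AK phi_eq entS.
have M0 : (0 < level q n * K`!)%N by rewrite muln_gt0 level0 fact_gt0.
have [d dP] := period_torsion_free M0; have [d0 dM _] := dP.
have [N K1N] := level_absorb q_gt0 (tf_primes tf) n K1b.
have [L LP] := orbit_equicontinuous_uniform X_compact phi_eq entS.
(* Split [d] along [level q n * K1] and [K2]. The first part divides [level q N]; the second is the
   order of a cyclic map and divides [K2], so it divides the number [h] of components for [K2]. *)
have dNh : (d %| level q N * h)%N.
  have : (d %| level q n * K1 * K2)%N by rewrite -mulnA -KE.
  move/dvdn_gcd_mul/dvdn_trans; apply; apply: dvdn_mul.
    by apply: dvdn_trans (dvdn_gcdr _ _) _; rewrite mulnC.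
  have gd : (gcdn d K2 %| d)%N by exact: dvdn_gcdl.
  have [g gP _] := cyclic_map_exists X_translate X_dense X_compact M0 dP gd Xx0.
  apply: (cyclic_map_dvd_period X_translate _ X0 hP gP (dvdn_gcdr _ _)).
  by rewrite gcdn_gt0 d0.
have [g gP _] := cyclic_map_exists X_translate X_dense X_compact M0 dP (dvdnn d) Xx0.
exists N => x y Xx Xy Fxy fxy.
have gxy : g x = g y.
  apply: (cyclic_map_factor X_translate X_dense _ _ _ _ (FP N).1 fP gP Xx Xy Fxy fxy) => //.
  move=> k; rewrite !dvdzE /= => Nk hk; apply: dvdn_trans dNh _.
  by rewrite Gauss_dvd ?Nk // coprime_sym; exact: coprime_level.
(* A translate of [x] by a multiple of the almost period agrees with [y] on the window: its image is
   close to [phi x] by [nP] and to [phi y] by [LP]. *)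
have [k ky] := cyclic_map_orbit_closure X_translate X_dense M0 dP gP Xx Xy gxy L.
apply: (entourage_split (phi (translate ((level q n * K`!)%N%:Z * k) x))) => //.
  by have := nP x k 0 Xx; rewrite translate0 add0r.
by have := LP _ _ (X_translate _ Xx) Xy ky 0; rewrite !translate0.
Qed.

End TorsionFree.

Lemma within_continuous_full_shift (A : finType) (X : set (full_shift A))
    (V : topologicalType) (phi : full_shift A -> V) :
  {within X, continuous phi} <->
  forall z B, X z -> nbhs (phi z) B ->
    exists L, forall x, X x -> agree L z x -> B (phi x).
Proof.
split=> [/subspace_continuousP phi_c z B Xz zB|H].
  have /nbhs_full_shift [L LP] := phi_c z Xz B zB.
  by exists L => x Xx zx; exact: LP.
apply/subspace_continuousP => z Xz B zB; have [L LP] := H z B Xz zB.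
by apply/nbhs_full_shift; exists L => x zx Xx; exact: LP.
Qed.

(** * Eigenvalues *)

Section Eigenvalue.
Variable R : realType.
Local Notation normc := (@ComplexField.Normc.normc R).

Lemma normc_ge0 (z : R[i]) : 0 <= normc z.
Proof. by case: z => a b; exact: sqrtr_ge0. Qed.

(** While powers stay near 1, squaring multiplies the distance to 1 by at least 3/2, so a nonzero
    distance would outgrow 1/2. *)
Lemma powers_near_one (mu : R[i]) :
  (forall m : nat, normc (1 - mu ^+ m) <= 2^-1) -> mu = 1.
Proof.
move=> mu_near; apply/esym/eqP; rewrite -subr_eq0; apply/eqP/ComplexField.Normc.eq0_normc.
apply/eqP; apply: contrapT => /negP r_neq0.
set r := normc (1 - mu) in r_neq0.
have r_gt0 : 0 < r by rewrite lt_neqAle eq_sym r_neq0 normc_ge0.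
(* [|1 + mu^m| >= 2 - |1 - mu^m| >= 3/2] *)
have double m : 3%:R / 2%:R * normc (1 - mu ^+ m) <= normc (1 - mu ^+ (m * 2)).
  rewrite exprM (_ : 1 - _ ^+ 2 = (1 - mu ^+ m) * (1 + mu ^+ m)); last by ring.
  rewrite ComplexField.Normc.normcM.
  rewrite mulrC ler_wpM2l ?normc_ge0 //.
  have := le_normcD (1 + mu ^+ m) (1 - mu ^+ m).
  rewrite addrACA subrr addr0 -[1 + 1]/(1 *+ 2) normcMn.
  by rewrite ComplexField.Normc.normc1; have := mu_near m; lra.
(* A linear lower bound for geometric growth, as in Bernoulli's inequality, is enough for the
   Archimedean property with [j] above [r^-1]. *)
have grow j : r * (1 + j%:R / 2%:R) <= normc (1 - mu ^+ (2 ^ j)).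
  elim: j => [|j IHj]; first by rewrite mul0r addr0 mulr1 expr1.
  rewrite expnSr; apply: le_trans (double _); rewrite -natr1.
  have : 0 <= r * j%:R by rewrite mulr_ge0 // ltW.
  by move: IHj; lra.
have := archi_boundP (ltW (_ : 0 < r^-1)); rewrite invr_gt0 => /(_ r_gt0).
set j := Num.bound _; rewrite -[r^-1]mulr1 ltr_pdivrMl // => jr.
by have := le_trans (grow j) (mu_near _); lra.
Qed.

Lemma translate_eigenvalue (A : finType) (X : set (full_shift A))
    (f : full_shift A -> R[i]) (lambda : R[i]) :
  (forall k x, X x -> X (translate k x)) ->
  lambda != 0 -> (forall x, X x -> f (left_shift x) = lambda * f x) ->
  forall x k, X x -> f (translate k x) = lambda ^ k * f x.
Proof.
move=> X_translate l0 fl.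
have natP x (n : nat) : X x -> f (translate n x) = lambda ^+ n * f x.
  move=> Xx; elim: n => [|n IHn]; first by rewrite translate0 mul1r.
  by rewrite intS translateD -left_shiftE fl ?IHn ?mulrA -?exprS //; exact: X_translate.
move=> x [n|n] Xx; first exact: natP.
have := natP _ n.+1 (X_translate (Negz n) _ Xx).
rewrite -translateD NegzE addrN translate0 => ->.
by rewrite -exprnN mulKf // expf_neq0.
Qed.

(** Multiplication by a power of [lambda] is an isometry, so continuity at [z] carries over to all
    translates with the same window. *)
Lemma eigenvalue_orbit_equicontinuous (A : finType) (X : set (full_shift A))
    (f : full_shift A -> R[i]^o) (lambda : R[i]) :
  (forall k x, X x -> X (translate k x)) ->
  `|lambda| = 1 -> (forall x, X x -> f (left_shift x) = lambda * f x) ->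
  {within X, continuous f} -> orbit_equicontinuous X f.
Proof.
move=> X_translate l1 fl /within_continuous_full_shift f_c E z entE Xz.
have l0 : lambda != 0 by rewrite -normr_eq0 l1 oner_neq0.
move: entE; rewrite -entourage_ballE => -[e /= e0 eE].
have [L LP] := f_c z _ Xz (nbhsx_ballx (f z) e e0).
exists L => x Xx zx k; apply: eE => /=; have := LP x Xx zx.
rewrite -!ball_normE /= !(translate_eigenvalue X_translate l0 fl) //.
rewrite -mulrBr normrM (_ : `|lambda ^ k| = 1) ?mul1r //.
by case: (k) => n; rewrite ?NegzE -?exprnN ?normfV normrX l1 expr1n ?invr1.
Qed.

End Eigenvalue.

Section TorsionFreeEigenvalue.
Variables (R : realType) (A : nat -> finType) (theta : directive_sequence A).
Variables (q : nat -> nat) (K : nat).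
Hypothesis tf : torsion_free theta q.
Hypothesis AK : forall n, (#|A n| <= K)%N.

Lemma eigenvalue_root_of_unity (lambda : R[i]) :
  continuous_eigenvalue (S_adic_shift theta 0%N) (@left_shift (A 0%N)) lambda ->
  exists2 k : nat, (0 < k)%N & lambda ^+ k = 1.
Proof.
case=> l1 [f [f_c [x Xx fx0] fl]].
have theta_q := tf_constant_length tf.
have X_translate := @S_adic_shift_translate A theta.
have f_eq := eigenvalue_orbit_equicontinuous X_translate l1 fl f_c.
have l0 : lambda != 0 by rewrite -normr_eq0 l1 oner_neq0.
(* With radius half of the modulus of [f x], dividing by that modulus leaves the bound 1/2 of
   [powers_near_one]. *)
pose e : R[i] := `|f x| * (2^-1)%:C%C.
have e0 : 0 < e by rewrite mulr_gt0 ?normr_gt0 // ltcR invr_gt0 ltr0n.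
have [n nP] := almost_period theta_q (tf_growth tf) AK f_eq (entourage_ball _ (PosNum e0)).
have X0 : S_adic_shift theta 0%N !=set0 by exists x.
exists (level q n * K`!)%N.
  by rewrite muln_gt0 fact_gt0 andbT level_gt0 // => i; exact: length_gt0 X0.
apply: powers_near_one => m; have := nP x m%:Z 0 Xx.
rewrite /= -ball_normE /= add0r translate0 (translate_eigenvalue X_translate l0 fl) //.
rewrite -PoszM -exprnP exprM -[X in X - _]mul1r -mulrBl normrM mulrC /e.
by rewrite ltr_pM2l ?normr_gt0 // => /ltW; rewrite lecR.
Qed.

End TorsionFreeEigenvalue.

(** * The odometer *)

Section Odometer.
Variable q : nat -> nat.
Hypothesis q_gt0 : forall n, (0 < q n)%N.

Let level0 n : (0 < level q n)%N. Proof. exact: level_gt0. Qed.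

Lemma inZp_cyclicD n (a b : 'I_(level q n.+1).-1.+1) :
  inZp (a + b)%R = inZp a + inZp b :> 'I_(level q n).-1.+1.
Proof.
have dv : ((level q n).-1.+1 %| (level q n.+1).-1.+1)%N by rewrite !prednK // level_dvd.
by apply: val_inj => /=; rewrite modn_dvdm // modnDm.
Qed.

Lemma inZp_cyclic_one n k :
  inZp (cyclic_one (level q n.+1) *~ k : 'I_(level q n.+1).-1.+1) = cyclic_one (level q n) *~ k.
Proof.
rewrite !(@cyclic_one_mulz_mod _ (level q n.+1) k) ?level_dvd // !cyclic_one_mulrn.
have dv : ((level q n).-1.+1 %| (level q n.+1).-1.+1)%N by rewrite !prednK // level_dvd.
by apply: val_inj => /=; rewrite modn_dvdm.
Qed.

Lemma odometer_level z w n N : odometer q z -> odometer q w -> (n <= N)%N ->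
  z N = w N -> z n = w n.
Proof.
move=> Mz Mw; elim: N => [|N IHN]; first by rewrite leqn0 => /eqP ->.
rewrite leq_eqVlt => /predU1P[-> //|]; rewrite ltnS => /IHN IH zw; apply: IH.
by rewrite Mz Mw zw.
Qed.

Variable h : nat.
Local Notation M := (odometer_cyclic q h).
Local Notation Z := (odometer_cyclic_space q h).

(** The integer powers of [rotation] in closed form, without the inverse [pinv] of [ziter]. *)
Definition rotationz (k : int) (z : Z) : Z :=
  (fun n => z.1 n + cyclic_one (level q n) *~ k, z.2 + cyclic_one h *~ k).

Lemma odometer_rotationz k z : M z -> M (rotationz k z).
Proof.
move=> [Mz _]; split=> // n /=.
by rewrite [RHS](inZp_cyclicD (z.1 n.+1 : 'I_(level q n.+1).-1.+1)) inZp_cyclic_one -Mz.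
Qed.

Lemma rotationz1 z : rotation z = rotationz 1 z.
Proof. by []. Qed.

Lemma rotationzD k l z : rotationz (k + l) z = rotationz k (rotationz l z).
Proof.
rewrite /rotationz; congr pair; [apply: functional_extensionality_dep => n /=|];
  by rewrite mulrzDr (addrC (_ *~ k)) addrA.
Qed.

Lemma rotationz0 z : rotationz 0 z = z.
Proof.
case: z => z1 z2; congr pair; [apply: functional_extensionality_dep => n /=|];
  by rewrite mulr0z addr0.
Qed.

Lemma rotation_bij : set_bij M M (@rotation q h).
Proof.
split=> [z Mz|z w _ _ zw|z Mz]; first exact: (@odometer_rotationz 1).
  by rewrite -[z]rotationz0 -[w]rotationz0 -(addNr 1) !rotationzD -!rotationz1 zw.
exists (rotationz (-1) z); first exact: odometer_rotationz.
by rewrite rotationz1 -rotationzD addrN rotationz0.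
Qed.

Lemma ziter_rotation k z : M z -> ziter M (@rotation q h) k z = rotationz k z.
Proof.
move=> Mz; rewrite -[in LHS](rotationz0 z); apply: (ziter_orbit (t := rotationz^~ z)).
- exact: rotation_bij.
- by move=> l; exact: odometer_rotationz.
- by move=> l; rewrite rotationz1 -rotationzD addrC.
Qed.

Lemma entourage_odometer (E : set (Z * Z)) : entourage E ->
  exists N, forall z w : Z, M z -> M w -> z.1 N = w.1 N -> z.2 = w.2 -> E (z, w).
Proof.
case=> -[E1 E2] /= [entE1 entE2] E12.
have [s sE1] := @entourage_prod_discrete nat (fun n => cyclic_group (level q n)) _ entE1.
(* In the odometer a coordinate determines all earlier ones, so the largest relevant one
   suffices. *)
exists (\max_(n <- s) n)%N => z w [Mz _] [Mw _] zw1 zw2.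
have : (E1 `*` E2) ((z.1, w.1), (z.2, w.2)).
  split=> /=; last by rewrite zw2; exact: entourage_refl.
  by apply: sE1 => n ns; apply: odometer_level zw1 => //; exact: leq_bigmax_seq.
move=> /E12 [[[a1 a2] [b1 b2]] /= Eab].
by case: z w {Mz Mw zw1 zw2} => [z1 z2] [w1 w2] /= [<- <- <- <-].
Qed.

Lemma nbhs_odometer (z : Z) N : nbhs z [set w : Z | z.1 N = w.1 N /\ z.2 = w.2].
Proof.
exists ([set u | z.1 N = u N], [set v | z.2 = v]); last by case=> u v [].
split=> /=; last first.
  rewrite (_ : [set v | _] = [set z.2]); first exact: (@discrete_set1 (cyclic_group h)).
  by apply/seteqP; split=> v /= ->.
apply/(@nbhs_prod_discrete nat (fun n => cyclic_group (level q n))).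
by exists [:: N] => y /(_ N (mem_head _ _)).
Qed.

Lemma odometer_hausdorff : hausdorff_space Z.
Proof.
move=> z w zw; rewrite [z]surjective_pairing [w]surjective_pairing.
have zwN N : z.1 N = w.1 N /\ z.2 = w.2.
  have [v [[-> ->] [-> ->]]] := zw _ _ (nbhs_odometer z N) (nbhs_odometer w N).
  by [].
congr pair; last exact: (zwN 0%N).2.
by apply: functional_extensionality_dep => N; exact: (zwN N).1.
Qed.

Lemma odometer_compact : compact M.
Proof.
apply: compact_setX; last by apply: finite_compact; exact: (@finite_finset 'I_h.-1.+1).
have cT : compact [set: odometer_space q].
  have cC n : compact [set: cyclic_group (level q n)].
    by apply: finite_compact; exact: (@finite_finset 'I_(level q n).-1.+1).
  have := @tychonoff nat (fun n => cyclic_group (level q n)) (fun=> setT) cC.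
  by congr compact; apply/seteqP; split.
apply: (subclosed_compact _ cT) => // z clz n.
have : nbhs z [set w : odometer_space q | w n = z n /\ w n.+1 = z n.+1].
  apply/(@nbhs_prod_discrete nat (fun n => cyclic_group (level q n))).
  by exists [:: n; n.+1] => w wz; split; apply: wz; rewrite !inE eqxx ?orbT.
by move/clz => [w [Mw [<- <-]]]; exact: Mw.
Qed.

(** Rotations preserve equality of coordinates, so one neighbourhood serves for all powers. *)
Lemma odometer_equicontinuous :
  @equicontinuous (subspace M) Z int setT (ziter M (@rotation q h)).
Proof.
move=> z E entE; have [N NE] := entourage_odometer entE.
rewrite /prop_near1; case: _ / (nbhs_subspaceP M z) => Mz; last first.
  (* Points outside [M] are isolated in the subspace. *)
  by move=> w /= -> i _; exact: entourage_refl.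
apply: filterS (nbhs_odometer z N) => w [zw1 zw2] Mw i _.
rewrite !ziter_rotation //; apply: NE; try exact: odometer_rotationz.
  by rewrite /= zw1.
by rewrite /= zw2.
Qed.

Lemma odometer_system : equicontinuous_system M (@rotation q h).
Proof.
split.
- exact: odometer_hausdorff.
- exact: odometer_compact.
- exact: (equicontinuous_continuous (i := 1%:Z) odometer_equicontinuous).
- exact: rotation_bij.
- exact: odometer_equicontinuous.
Qed.

End Odometer.

(** * Equicontinuous factors of a subshift *)

Lemma factor_translate (A : finType) (X : set (full_shift A)) (V : puniformType)
    (Y : set V) (S : V -> V) (phi : full_shift A -> V) :
  (forall k x, X x -> X (translate k x)) -> set_bij Y Y S ->
  factor_map X (@left_shift A) Y S phi ->
  forall k x, X x -> phi (translate k x) = ziter Y S k (phi x).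
Proof.
move=> X_translate S_bij [_ phiX phiS] k x Xx.
rewrite -[in RHS](translate0 x); symmetry.
apply: (ziter_orbit (t := fun k => phi (translate k x))) => // l.
  by rewrite -phiX; exists (translate l x) => //; exact: X_translate.
by rewrite addrC translateD -left_shiftE phiS //; exact: X_translate.
Qed.

(** Continuity brings [phi x] close to [phi z] within [Y], and equicontinuity keeps all their images
    under powers of [S] close. *)
Lemma factor_orbit_equicontinuous (A : finType) (X : set (full_shift A))
    (V : puniformType) (Y : set V) (S : V -> V) (phi : full_shift A -> V) :
  (forall k x, X x -> X (translate k x)) ->
  equicontinuous_system Y S -> factor_map X (@left_shift A) Y S phi ->
  orbit_equicontinuous X phi.
Proof.
move=> X_translate [_ _ _ S_bij S_eq] phiP E z entE Xz.
have [/within_continuous_full_shift phi_c phiX _] := phiP.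
have Yphi x : X x -> Y (phi x) by move=> Xx; rewrite -phiX; exists x.
have := S_eq (phi z) E entE; rewrite /prop_near1.
rewrite -[nbhs _]/(nbhs_subspace (phi z : subspace Y)) -nbhs_subspace_in; last exact: Yphi.
move=> /(phi_c z _ Xz) [L LP]; exists L => x Xx zx k.
rewrite !(factor_translate X_translate S_bij phiP) //.
by apply: LP => //; exact: Yphi.
Qed.

(** * The maximal equicontinuous factor *)

Section MaximalEquicontinuousFactor.
Variables (A : nat -> finType) (theta : directive_sequence A) (q : nat -> nat).
Hypothesis tf : torsion_free theta q.
Local Notation X := (S_adic_shift theta 0%N).
Local Notation T := (@left_shift (A 0%N)).
Implicit Types (x y : full_shift (A 0%N)).

Variables (x0 : full_shift (A 0%N)) (h : nat).
Variables (F : forall n, full_shift (A 0%N) -> cyclic_group (level q n)).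
Variable (f : full_shift (A 0%N) -> cyclic_group h).
Hypothesis Xx0 : X x0.
Hypothesis h_gt0 : (0 < h)%N.
Hypothesis h_coprime : forall n, coprime h (q n).
Hypothesis F_cyclic : forall n, cyclic_map X (F n).
Hypothesis Fx0 : forall n, F n x0 = 0.
Hypothesis f_cyclic : cyclic_map X f.
Hypothesis fx0 : f x0 = 0.
Hypothesis Ff_determines : forall (V : uniformType) (phi : full_shift (A 0%N) -> V) E,
  orbit_equicontinuous X phi -> entourage E ->
  exists N, forall x y, X x -> X y -> F N x = F N y -> f x = f y -> E (phi x, phi y).

Let X_translate := @S_adic_shift_translate A theta.
Let X_dense := S_adic_dense (tf_minimal tf 0%N).
Let q_gt0 n : (0 < q n)%N.
Proof. by apply: (length_gt0 (tf_constant_length tf)); exists x0. Qed.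

Definition odometer_map x : odometer_cyclic_space q h := (fun n => F n x, f x).

(** The compatibility of levels is clear on the orbit of [x0], where each [F n] counts the shift; a
    window determining two levels transfers it to [x]. *)
Lemma odometer_map_in x : X x -> odometer_cyclic q h (odometer_map x).
Proof.
move=> Xx; split=> // n /=.
have [L LP] := (F_cyclic n).2; have [L' LP'] := (F_cyclic n.+1).2.
have [k kx] := X_dense Xx0 Xx (maxn L L').
rewrite -(LP _ _ (X_translate k Xx0) Xx (agree_leq (leq_maxl _ _) kx)).
rewrite -(LP' _ _ (X_translate k Xx0) Xx (agree_leq (leq_maxr _ _) kx)).
by rewrite (F_cyclic n).1 // (F_cyclic n.+1).1 // !Fx0 !add0r (inZp_cyclic_one q_gt0).
Qed.

(** By the Chinese remainder theorem some translate of [x0] has the prescribed values at level [n]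
    and modulo [h]; an accumulation point of these translates is a preimage of [z]. *)
Lemma odometer_map_surj z : odometer_cyclic q h z -> exists2 x, X x & odometer_map x = z.
Proof.
move=> [Mz _].
have /choice [k kP] : forall n, exists k : int,
    cyclic_one (level q n) *~ k = z.1 n /\ cyclic_one h *~ k = z.2.
  move=> n; have co : coprime (level q n) h by rewrite coprime_sym; exact: coprime_level.
  exists (chinese (level q n) h (z.1 n : 'I__) (z.2 : 'I__))%:Z.
  split; apply: cyclic_one_mulrn_mod => //; first exact: level_gt0.
    exact: chinese_modl.
  exact: chinese_modr.
have [x Xx xP] := S_adic_compact (fun n => X_translate (k n) Xx0).
exists x => //; rewrite [z]surjective_pairing; congr pair.
  apply: functional_extensionality_dep => n; have [L LP] := (F_cyclic n).2.
  have [m mL mx] := xP (maxn n L).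
  rewrite -(LP _ _ (X_translate (k m) Xx0) Xx (agree_leq (leq_maxr _ _) mx)).
  rewrite (F_cyclic n).1 // Fx0 add0r.
  (* Only level [m] is prescribed for the translate by [k m]; since [n <= m], it determines level
     [n]. *)
  apply: (odometer_level (z := fun n => cyclic_one (level q n) *~ k m) _ Mz (leq_trans (leq_maxl _ _) mL)).
    by move=> i; rewrite (inZp_cyclic_one q_gt0).
  exact: (kP m).1.
have [L LP] := f_cyclic.2; have [m mL mx] := xP L.
by rewrite -(LP _ _ (X_translate (k m) Xx0) Xx mx) f_cyclic.1 // fx0 add0r; exact: (kP m).2.
Qed.

Lemma odometer_map_factor :
  factor_map X T (odometer_cyclic q h) (@rotation q h) odometer_map.
Proof.
split.
- apply/within_continuous_full_shift => z B Xz /nbhsP[E entE EB].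
  have [N NP] := entourage_odometer entE.
  have [L LP] := (F_cyclic N).2; have [L' LP'] := f_cyclic.2.
  exists (maxn L L') => x Xx zx; apply: EB; apply/xsectionP; apply: NP.
  + exact: odometer_map_in.
  + exact: odometer_map_in.
  + by apply: LP => //; exact: agree_leq (leq_maxl _ _) zx.
  + by apply: LP' => //; exact: agree_leq (leq_maxr _ _) zx.
- apply/seteqP; split=> [_ [x Xx <-]|z /odometer_map_surj [x Xx <-]].
    exact: odometer_map_in.
  by exists x.
- move=> x Xx; rewrite /odometer_map /rotation left_shiftE f_cyclic.1 //; congr pair.
  by apply: functional_extensionality_dep => n; rewrite (F_cyclic n).1.
Qed.

(** A competing [phi] factors through [odometer_map], since points with the same image have
    [phi]-values in every entourage, hence equal in a Hausdorff space. *)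
Lemma odometer_map_maximal :
  is_maximal_equicontinuous_factor X T (odometer_cyclic q h) (@rotation q h).
Proof.
split; first exact: odometer_system.
exists odometer_map; first exact: odometer_map_factor.
move=> V Y S phi Y_eq phiP.
have phi_eq := factor_orbit_equicontinuous X_translate Y_eq phiP.
have [V_hausdorff _ _ _ _] := Y_eq; have [_ phiX phiT] := phiP.
have [_ mapX mapT] := odometer_map_factor.
(* A preimage is chosen for each [z]; the default [x0] matters only off the image of [X]. *)
pose psi z := phi (xget x0 [set x | X x /\ odometer_map x = z]).
have psiE x : X x -> psi (odometer_map x) = phi x.
  move=> Xx; rewrite /psi; case: xgetP => [y _ [Xy yx]|/(_ x)/=/not_andP[]//].
  apply: hausdorff_entourage_eq => // E entE; have [N NP] := Ff_determines phi_eq entE.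
  by apply: NP => //; [have := congr1 (fun z => z.1 N) yx|have := congr1 snd yx].
exists psi => [|x Xx]; last by rewrite psiE.
split.
- apply/subspace_continuousP => z /odometer_map_surj [x Xx <-] B xB.
  have /nbhsP[E entE EB] : nbhs (phi x) B by rewrite -psiE.
  have [N NP] := Ff_determines phi_eq entE.
  apply: filterS (nbhs_odometer (odometer_map x) N) => w [/= FN fN] /odometer_map_surj [y Xy yE].
  move: FN fN; rewrite -yE /= => FN fN; suff : B (phi y) by rewrite -psiE.
  apply: EB; apply/xsectionP; exact: NP.
- rewrite -phiX -mapX; apply/seteqP; split=> [_ [_ [x Xx <-] <-]|_ [x Xx <-]].
    by rewrite psiE //; exists x.
  by exists (odometer_map x); [exists x|exact: psiE].
- move=> z /odometer_map_surj [x Xx <-]; rewrite -mapT // !psiE ?phiT //.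
  exact: X_translate.
Qed.

End MaximalEquicontinuousFactor.

Theorem corollary21 (R : realType) (A : nat -> finType)
    (theta : directive_sequence A) (q : nat -> nat) :
  torsion_free theta q -> bounded_alphabets A ->
  (exists h : nat,
     [/\ (0 < h)%N, forall n, coprime h (q n)
       & is_maximal_equicontinuous_factor
           (S_adic_shift theta 0%N) (@left_shift (A 0%N))
           (odometer_cyclic q h) (@rotation q h)]) /\
  (forall lambda : R[i],
     continuous_eigenvalue (S_adic_shift theta 0%N) (@left_shift (A 0%N)) lambda ->
     exists2 k : nat, (0 < k)%N & lambda ^+ k = 1).
Proof.
move=> tf [K AK]; split; last by move=> lambda; exact: eigenvalue_root_of_unity tf AK _.
have [[x0 Xx0] _] := tf_minimal tf 0%N.
have [h [F [f [[h0 hq] FP [fP fx0] Ff]]]] := cyclic_structure tf AK Xx0.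
exists h; split=> //; apply: (odometer_map_maximal tf Xx0 h0 hq _ _ fP fx0 Ff) => n.
  exact: (FP n).1.
exact: (FP n).2.
Qed.
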